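(* Let $T$ be an invertible ergodic measure preserving transformation of a Lebesgue probability space $(\mathcal{X}, \mathcal{S}, \mu)$. If $\mathcal{C} \subseteq \mathcal{S}$ is a class of measurable sets in $\mathcal{X}$ such that $H_\mu(\mathcal{C}) > 0$, then there exists a dense $G_\delta$ set $G \subset \Phi$ such that for each $\phi \in G$, $$\limsup_{n \to \infty} \, \sup_{C \in \mathcal{C}} \int \Big| \frac{1}{n} \sum_{i=0}^{n-1} I_C(T_\phi^i x) - \mu(C) \Big| \, d\mu(x) > 0.$$
   Context: A Lebesgue probability space is a probability space isomorphic (modulo null sets) to the unit interval $[0,1)$ with Lebesgue measure. $I_C$ denotes the indicator function of $C$. $\Phi$ is the space of invertible measure preserving transformations of $(\mathcal{X}, \mathcal{S}, \mu)$, where transformations agreeing $\mu$-almost everywhere are identified, endowed with the weak topology: $\phi_r \to \phi$ if $\lim_{r\to\infty} \mu(\phi_r A \, \triangle \, \phi A) = 0$ for all $A \in \mathcal{S}$. For a measure preserving transformation $T$ and $\phi \in \Phi$, $T_\phi = \phi^{-1} \circ T \circ \phi$. Entropy of a family. For a finite measurable partition $\Pi$ of $\mathcal{X}$, $H_\mu(\Pi) = -\sum_{A \in \Pi} \mu(A) \log \mu(A)$, with logarithms base 2 (cells are assumed, without loss of generality, to have positive measure, i.e. null cells contribute 0). For measurable sets $C_1, \ldots, C_n$, the join $\vee_{i=1}^n C_i$ is the partition of $\mathcal{X}$ with cells $\tilde{C}_1 \cap \cdots \cap \tilde{C}_n$, where each $\tilde{C}_i \in \{C_i, C_i^c\}$.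 For an ordered sequence $\mathbb{S} = (C_1, C_2, \ldots)$ of sets $C_i \in \mathcal{C}$, let $H_\mu(\mathbb{S}) = \liminf_{n\to\infty} \frac{1}{n} H_\mu(\vee_{i=1}^n C_i)$. The entropy of the family $\mathcal{C} \subseteq \mathcal{S}$ is $H_\mu(\mathcal{C}) = \sup H_\mu(\mathbb{S})$, where the supremum is over all ordered sequences $\mathbb{S}$ of sets in $\mathcal{C}$. *)

(* Defs.v *)
From HB Require Import structures.
From mathcomp Require Import all_boot all_order all_algebra.
From mathcomp Require Import finmap.
From mathcomp Require Import all_classical all_reals all_analysis.

Set Implicit Arguments.
Unset Strict Implicit.
Unset Printing Implicit Defensive.

Import Order.TTheory GRing.Theory Num.Theory.
Import numFieldNormedType.Exports.

Local Open Scope classical_set_scope.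
Local Open Scope ring_scope.

(* A point isomorphism between (X, mu) and the measurable subset E of (Y, nu),
   defined off null sets. *)
Definition mod0_isomorphic (R : realType) (d1 d2 : measure_display)
    (X : measurableType d1) (Y : measurableType d2)
    (mu : {measure set X -> \bar R}) (nu : {measure set Y -> \bar R})
    (E : set Y) : Prop :=
  exists (N : set X) (M : set Y) (f : X -> Y),
    [/\ measurable N /\ mu N = 0%E,
        measurable M /\ nu M = 0%E,
        set_bij (~` N) (E `\` M) f,
        (forall A, A `<=` ~` N -> (measurable A <-> measurable (f @` A))) &
        (forall A, A `<=` ~` N -> measurable A -> nu (f @` A) = mu A)].

(* [0, 1) may carry either its Borel sets or its Lebesgue-measurable sets;
   both conventions are in use, and neither space is isomorphic to the other in
   the sense above, since a Borel space is never complete. *)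
Definition lebesgue_space (R : realType) (d : measure_display)
    (X : measurableType d) (P : probability X R) : Prop :=
  mod0_isomorphic P (@lebesgue_measure R) `[0%R, 1%R[%classic \/
  mod0_isomorphic P (@completed_lebesgue_measure R) `[0%R, 1%R[%classic.

Record invertible_mpt (R : realType) (d : measure_display)
    (X : measurableType d) (P : probability X R) := InvertibleMpt {
  mpt_fun :> X -> X ;
  mpt_inv : X -> X ;
  mpt_funK : cancel mpt_fun mpt_inv ;
  mpt_invK : cancel mpt_inv mpt_fun ;
  measurable_mpt_fun : measurable_fun setT mpt_fun ;
  measurable_mpt_inv : measurable_fun setT mpt_inv ;
  mpt_preserving : forall A, measurable A -> P (mpt_fun @^-1` A) = P A }.

Definition ergodic (R : realType) (d : measure_display)
    (X : measurableType d) (P : probability X R) (T : invertible_mpt P) : Prop :=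
  forall A, measurable A -> T @^-1` A = A -> P A = 0%E \/ P A = 1%E.

Section Phi.
Context (R : realType) (d : measure_display) (X : measurableType d).
Variable P : probability X R.

HB.instance Definition _ := gen_eqMixin (invertible_mpt P).
HB.instance Definition _ := gen_choiceMixin (invertible_mpt P).

Definition mpt_ae_eq (f g : invertible_mpt P) : bool :=
  `[< {ae P, forall x, f x = g x} >].

Let mpt_ae_eq_refl : reflexive mpt_ae_eq.
Proof. by move=> f; apply/asboolP/aeW. Qed.

Let mpt_ae_eq_sym : symmetric mpt_ae_eq.
Proof.
by move=> f g; apply/idP/idP => /asboolP h; apply/asboolP; apply: filterS h.
Qed.

Let mpt_ae_eq_trans : transitive mpt_ae_eq.
Proof.
move=> g f h /asboolP fg /asboolP gh; apply/asboolP.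
by apply: filterS2 fg gh => x -> ->.
Qed.

Canonical mpt_ae_eq_equiv :=
  EquivRel mpt_ae_eq mpt_ae_eq_refl mpt_ae_eq_sym mpt_ae_eq_trans.

Local Open Scope quotient_scope.

Definition Phi : Type := {eq_quot mpt_ae_eq}.
HB.instance Definition _ := Choice.on Phi.
HB.instance Definition _ := EqQuotient.on Phi.

(* The image phi @` A and the conjugates by phi depend on the chosen
   representative only up to null sets. *)
Definition Phi_repr (phi : Phi) : invertible_mpt P := repr phi.
Coercion Phi_repr : Phi >-> invertible_mpt.

(* The sets U(phi, A, e) form a subbase of the weak topology; the sequences
   that converge for it are described by weak_cvgP. *)
Definition weak_subbase : set (set Phi) :=
  [set U | exists (phi : Phi) (A : set X) (e : R),
     [/\ measurable A, 0 < e &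
         U = [set psi : Phi | (P (psi @` A `+` phi @` A) < e%:E)%E]]].

HB.instance Definition _ :=
  @isSubBaseTopological.Build Phi (set Phi) weak_subbase idfun.

End Phi.

Section weak_topology_sequences.
Context (R : realType) (d : measure_display) (X : measurableType d).
Variable P : probability X R.

Lemma measurable_mpt_image (phi : invertible_mpt P) (A : set X) :
  measurable A -> measurable (phi @` A).
Proof.
move=> mA; have -> : phi @` A = mpt_inv phi @^-1` A.
  apply/seteqP; split => [_ [x Ax <-]|y Ay] /=; first by rewrite mpt_funK.
  by exists (mpt_inv phi y) => //; rewrite mpt_invK.
by rewrite -[X in measurable X]setTI; exact: measurable_mpt_inv.
Qed.

Let measureY_triangle (A B C : set X) :
  measurable A -> measurable B -> measurable C ->
  (P (A `+` C) <= P (A `+` B) + P (B `+` C))%E.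
Proof.
move=> mA mB mC.
have mY (D E : set X) : measurable D -> measurable E -> measurable (D `+` E).
  by move=> mD mE; apply: measurableU; exact: measurableD.
have := @measureU2 _ _ _ P _ _ (mY _ _ mA mB) (mY _ _ mB mC).
apply: le_trans.
apply: le_measure; rewrite ?inE; [exact: mY|by apply: measurableU; exact: mY|].
move=> x [[Ax nCx]|[Cx nAx]]; have [Bx|nBx] := pselect (B x).
- by right; left.
- by left; left.
- by left; right.
- by right; right.
Qed.

Lemma weak_cvgP (phi_ : nat -> Phi P) (phi : Phi P) :
  phi_ @ \oo --> phi <->
  forall A, measurable A ->
    (fun r => P (phi_ r @` A `+` phi @` A)) @ \oo --> 0%E.
Proof.
have mI (f : Phi P) A : measurable A -> measurable (f @` A).
  exact: measurable_mpt_image.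
have finP (f g : Phi P) A : measurable A -> P (f @` A `+` g @` A) \is a fin_num.
  move=> mA; apply: fin_num_measure.
  by apply: measurableU; apply: measurableD; exact: mI.
split=> [cvphi A mA|cvA].
- apply/fine_cvgP; split; first by apply: nearW => r; exact: finP.
  apply/cvgrPdist_lt => e e0.
  pose U := [set psi : Phi P | (P (psi @` A `+` phi @` A) < e%:E)%E].
  have UU : nbhs phi U.
    rewrite nbhsE; exists U => //; split; last first.
      by rewrite /U /= setYK measure0 lte_fin.
    exists [set U]; last by rewrite bigcup_set1.
    move=> _ ->; exists [fset U]%fset; last by rewrite set_fset1 bigcap_set1.
    by move=> V /fset1P ->; rewrite inE; exists phi, A, e.
  near=> r.
  rewrite /= sub0r normrN ger0_norm ?fine_ge0//.
  rewrite -lte_fin fineK ?finP//.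
  by have : U (phi_ r) by near: r; exact: cvphi.
- move=> V; rewrite /= nbhsE.
  move=> [_ [[B sB <-] [C BC Cphi] sUV]].
  rewrite nbhs_filterE; apply: filterS sUV _; apply: (@filterS _ _ _ C).
    by move=> ? ?; exists C.
  have /sB [D sD IDeC] := BC; rewrite -IDeC; apply: filter_bigI => E DE.
  have /sD := DE; rewrite inE => -[psi [A [e [mA e0 EE]]]].
  have Ephi : E phi by move: Cphi; rewrite -IDeC => /(_ _ DE).
  rewrite EE /= in Ephi *.
  move/fine_cvgP : (cvA A mA) => [_] /cvgrPdist_lt.
  pose del := e - fine (P (phi @` A `+` psi @` A)).
  have del0 : 0 < del by rewrite subr_gt0 -lte_fin fineK ?finP.
  move=> /(_ _ del0) near_del.
  near=> r => /=.
  apply: le_lt_trans (@measureY_triangle (phi_ r @` A) (phi @` A) (psi @` A)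
    (mI _ _ mA) (mI _ _ mA) (mI _ _ mA)) _.
  have : `|0 - fine (P (phi_ r @` A `+` phi @` A))| < del by near: r.
  rewrite sub0r normrN ger0_norm ?fine_ge0// /del ltrBrDr -lte_fin EFinD.
  by rewrite !fineK ?finP.
Unshelve. all: by end_near. Qed.

End weak_topology_sequences.

Definition conjugate (R : realType) (d : measure_display)
    (X : measurableType d) (P : probability X R)
    (T phi : invertible_mpt P) : X -> X :=
  mpt_inv phi \o T \o phi.

Definition log2 (R : realType) (x : R) : R := ln x / ln 2.

(* Null cells contribute 0 because of the factor fine (P A). *)
Definition partition_entropy (R : realType) (d : measure_display)
    (X : measurableType d) (P : probability X R) (Pi : set (set X)) : R :=
  - \sum_(A \in Pi) (fine (P A) * log2 (fine (P A))).

(* The cells of the join of S 0, ..., S n.-1; empty cells are included. *)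
Definition join_partition (X : Type) (S : nat -> set X) (n : nat) :
    set (set X) :=
  [set \bigcap_(i in `I_n) (if b i then S i else ~` S i) |
     b in [set: nat -> bool]].

Definition sequence_entropy (R : realType) (d : measure_display)
    (X : measurableType d) (P : probability X R) (S : nat -> set X) : \bar R :=
  limn_einf (fun n : nat =>
    (n%:R^-1 * partition_entropy P (join_partition S n))%:E).

Definition family_entropy (R : realType) (d : measure_display)
    (X : measurableType d) (P : probability X R) (C : set (set X)) : \bar R :=
  ereal_sup [set sequence_entropy P S |
    S in [set S : nat -> set X | forall i, C (S i)]].

(* Main.v *)
(* The mean ergodic averages of phi @` A under T are compared with a nearly
   T-invariant set W of measure about 1/2.

   Positive entropy gives c > 0 such that no finite partition Q approximates
   every member of C within c: otherwise the joins of members of C would have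
   entropy at most log #|Q| + n * (small), by Gibbs' inequality.
   Fix Q and let A in C be c-far from all unions of cells of Q. Since T is
   ergodic, some W satisfies mu(T^-1 W + W) ~ 0 and mu(W /\ q) ~ mu(q)/2 for all
   cells q, and some sigma in the full group of T preserves Q and pushes as much
   of A as possible into W. Then mu(sigma A /\ W) - mu(A) mu(W) >= c/4 and the
   near invariance of W keeps this correlation for n iterations of T, so that the
   n-th average of sigma A is bounded away from mu(A) in L^1.
   As sigma fixes every cell of Q, such transformations are dense for the weak
   topology; they also form an open set for each n, and Phi is a Baire space. *)
Require Import Defs.
From HB Require Import structures.
From mathcomp Require Import all_boot all_order all_algebra.
From mathcomp Require Import finmap ring lra zify.
From mathcomp Require Import all_classical all_reals all_analysis.
From mathcomp Require Import measurable_realfun borel_hierarchy.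

Import Order.TTheory GRing.Theory Num.Theory.
Import numFieldNormedType.Exports.

Local Open Scope classical_set_scope.
Local Open Scope ring_scope.

Set Implicit Arguments.
Unset Strict Implicit.
Unset Printing Implicit Defensive.

(** Testing the averages against the indicator of $W$ replaces a direct estimate of their $L^1$
    norm. The resulting correlation is Lipschitz in the image of $A$, hence gives an open condition
    on $\phi$, and one threshold $c/4$ serves every $n$. The correlation appears because $W$ has
    room for half of every cell, while $A$ is far from being evenly absorbed by unions of cells.

    $W$ has to be nearly invariant and to halve all cells at once. Labelling points by their first
    visit to a small set $E$ gives the invariance, since the label persists along an orbit until it
    meets $E$; a choice of signs for the labels gives the halving.

    The Baire property is the other half of the work. A limit of images of sets has to be realised
    by a point map, and a limit of the $\phi_k$ alone may fail to be invertible. The nested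
    neighbourhoods therefore control $\phi_k$ and $\phi_k^{-1}$ in measure through a real
    coordinate; the two pointwise limits are inverse to each other almost everywhere, and a null set
    is then repaired. The coordinate also hides whether $[0,1)$ carries Borel or Lebesgue sets. *)

Lemma measurable_preimageT d d' (X : measurableType d) (Y : measurableType d')
    (f : X -> Y) (A : set Y) :
  measurable_fun setT f -> measurable A -> measurable (f @^-1` A).
Proof. by move=> mf mA; rewrite -[X in measurable X]setTI; exact: mf. Qed.

(** * Finite partitions as label maps *)

Section measurable_labels.
Context (d : measure_display) (X : measurableType d) (I : finType) (Y : X -> I).
Hypothesis mY : forall i, measurable [set x | Y x = i].

Lemma measurable_label (p : pred I) : measurable [set x | p (Y x)].
Proof.
rewrite (_ : [set x | _] = \bigcup_(i in [set i | p i]) [set x | Y x = i]).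
  by apply: fin_bigcup_measurable => //; exact: finite_finset.
by apply/seteqP; split=> x /=; [exists (Y x)|case=> i /= pi ->].
Qed.

(** This is the symmetric difference of [A] and the union of the cells selected by [s]: partitions
    are given by label maps, unions of cells by Boolean predicates on labels. *)
Lemma measurable_label_neq (A : set X) (s : pred I) : measurable A ->
  measurable [set x | `[< A x >] != s (Y x)].
Proof.
move=> mA; have ms := measurable_label s.
rewrite (_ : [set x | _] = (A `\` [set x | s (Y x)]) `|` ([set x | s (Y x)] `\` A)).
  by apply: measurableU; exact: measurableD.
apply/seteqP; split=> x; rewrite /setU /setD /=; case: asboolP => Ax.
- by move=> /negP sx; left.
- by rewrite negbK => sx; right.
- by case=> [[_ /negP]|[_ /(_ Ax)]].
- by case=> [[]|[/= ->]].
Qed.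

End measurable_labels.

(** * Real-valued probabilities and measure preserving transformations *)

Section real_probability.
Context (R : realType) (d : measure_display) (X : measurableType d).
Variable P : probability X R.
Implicit Types A B D E : set X.

Definition pr A : R := fine (P A).

Lemma prE A : measurable A -> P A = (pr A)%:E.
Proof. by move=> mA; rewrite /pr fineK// fin_num_measure. Qed.

Lemma pr_ge0 A : 0 <= pr A.
Proof. exact/fine_ge0/measure_ge0. Qed.

Lemma pr0 : pr set0 = 0.
Proof. by rewrite /pr measure0. Qed.

Lemma prT : pr setT = 1.
Proof. by rewrite /pr probability_setT. Qed.

Lemma pr_le A B : measurable A -> measurable B -> A `<=` B -> pr A <= pr B.
Proof.
by move=> mA mB AB; rewrite -lee_fin -!prE//; apply: le_measure; rewrite ?inE.
Qed.

Lemma prU A B : measurable A -> measurable B -> [disjoint A & B] ->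
  pr (A `|` B) = pr A + pr B.
Proof.
move=> mA mB /disj_set2P AB; apply/EFin_inj.
by rewrite EFinD -!prE//; [exact: measureU|exact: measurableU].
Qed.

Lemma prU2 A B : measurable A -> measurable B -> pr (A `|` B) <= pr A + pr B.
Proof.
move=> mA mB; rewrite -lee_fin EFinD -!prE//; last exact: measurableU.
exact: measureU2.
Qed.

Lemma prID A B : measurable A -> measurable B ->
  pr A = pr (A `&` B) + pr (A `\` B).
Proof.
move=> mA mB; rewrite -prU; last 3 first.
- exact: measurableI.
- exact: measurableD.
- by apply/disj_set2P; rewrite setDE setIACA setICr setI0.
by rewrite setUIDK.
Qed.

Lemma pr_le1 A : measurable A -> pr A <= 1.
Proof. by move=> mA; rewrite -prT; apply: pr_le. Qed.

Lemma prC A : measurable A -> pr (~` A) = 1 - pr A.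
Proof.
move=> mA; have := prID (@measurableT _ X) mA.
by rewrite prT setTI setTD => ->; rewrite addrC addKr.
Qed.

Lemma measurableY A B : measurable A -> measurable B -> measurable (A `+` B).
Proof. by move=> mA mB; apply: measurableU; exact: measurableD. Qed.

Lemma pr_dist A B : measurable A -> measurable B ->
  `|pr A - pr B| <= pr (A `+` B).
Proof.
move=> mA mB; have mY := measurableY mA mB.
have mD : measurable (A `\` B) by exact: measurableD.
have mD' : measurable (B `\` A) by exact: measurableD.
have := pr_le mD mY (@subsetUl _ _ _).
have := pr_le mD' mY (@subsetUr _ _ _).
rewrite (prID mA mB) (prID mB mA) (setIC B A) ler_norml.
have := pr_ge0 (A `\` B); have := pr_ge0 (B `\` A); lra.
Qed.

Lemma pr_setY_triangle B A D : measurable A -> measurable B -> measurable D ->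
  pr (A `+` D) <= pr (A `+` B) + pr (B `+` D).
Proof.
move=> mA mB mD; apply: le_trans (prU2 (measurableY mA mB) (measurableY mB mD)).
apply: pr_le; [exact: measurableY|by apply: measurableU; exact: measurableY|].
move=> x [[Ax nCx]|[Cx nAx]]; have [Bx|nBx] := pselect (B x).
- by right; left.
- by left; left.
- by left; right.
- by right; right.
Qed.

Lemma pr_distI A B D : measurable A -> measurable B -> measurable D ->
  `|pr (A `&` D) - pr (B `&` D)| <= pr (A `+` B).
Proof.
move=> mA mB mD; apply: le_trans (pr_dist _ _) _; [exact: measurableI..|].
apply: pr_le; [|exact: measurableY|].
  by apply: measurableY; exact: measurableI.
by move=> x [[[Ax Dx] nB]|[[Bx Dx] nA]]; [left|right]; split=> // Z;
  [apply: nB|apply: nA].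
Qed.

Section labels.
Variables (I : finType) (Y : X -> I).
Hypothesis mY : forall i, measurable [set x | Y x = i].

Let label_seq A (s : seq I) : measurable A -> uniq s ->
  measurable (A `&` [set x | Y x \in s]) /\
  pr (A `&` [set x | Y x \in s]) = \sum_(i <- s) pr (A `&` [set x | Y x = i]).
Proof.
move=> mA; elim: s => [|i s IHs] /=.
  have -> : [set x | Y x \in [::]] = set0 by apply/seteqP; split.
  by rewrite setI0 big_nil pr0.
case/andP => si /IHs[ms prs]; rewrite big_cons -prs.
have -> : A `&` [set x | Y x \in i :: s] =
    (A `&` [set x | Y x = i]) `|` (A `&` [set x | Y x \in s]).
  rewrite -setIUr; congr (A `&` _); apply/seteqP; split=> x /=; rewrite in_cons.
    by case/predU1P; [left|right].
  by case=> [->|->]; rewrite ?eqxx ?orbT.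
have mi := measurableI _ _ mA (mY i).
split; first exact: measurableU.
rewrite prU//; apply/disj_set2P/seteqP; split=> // x [[_ /= ->] [_ /=]].
by rewrite (negbTE si).
Qed.

Lemma pr_label A (p : pred I) : measurable A ->
  pr (A `&` [set x | p (Y x)]) = \sum_(i | p i) pr (A `&` [set x | Y x = i]).
Proof.
move=> mA; have [_] := @label_seq A (enum p) mA (enum_uniq _).
rewrite big_enum /= => <-; congr (pr (A `&` _)).
by apply/seteqP; split=> x /=; rewrite mem_enum.
Qed.

End labels.

Lemma pr_nondecreasing_cvg (F : (set X)^nat) :
  (forall i, measurable (F i)) -> nondecreasing_seq F ->
  pr (F n) @[n --> \oo] --> pr (\bigcup_n F n).
Proof.
move=> mF ndF; have mU := bigcupT_measurable _ mF.
have : P (F n) @[n --> \oo] --> P (\bigcup_n F n).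
  exact: nondecreasing_cvg_mu.
by rewrite prE// => /fine_cvgP[].
Qed.

Lemma pr_nonincreasing_cvg (F : (set X)^nat) :
  (forall i, measurable (F i)) -> nonincreasing_seq F ->
  pr (F n) @[n --> \oo] --> pr (\bigcap_n F n).
Proof.
move=> mF niF; have mU := bigcapT_measurable mF.
have Foo : (P (F 0%N) < +oo)%E by rewrite prE// ltry.
have : P (F n) @[n --> \oo] --> P (\bigcap_n F n).
  exact: nonincreasing_cvg_mu.
by rewrite prE// => /fine_cvgP[].
Qed.

Lemma pr_bigcup0 (F : (set X)^nat) :
  (forall i, measurable (F i)) -> (forall i, pr (F i) = 0) ->
  pr (\bigcup_n F n) = 0.
Proof.
move=> mF F0; have mU := bigcupT_measurable _ mF.
apply/EFin_inj; rewrite -prE//.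
apply/eqP; rewrite eq_le measure_ge0 andbT.
apply: le_trans (measure_sigma_subadditive P mF mU (@subset_refl _ _)) _.
by rewrite eseries0// => i _ _ /=; have := prE (mF i); rewrite F0.
Qed.

Lemma pr_subset0 A B : measurable A -> measurable B -> A `<=` B -> pr B = 0 ->
  pr A = 0.
Proof.
by move=> mA mB AB B0; apply/eqP; rewrite eq_le pr_ge0 andbT -B0; apply: pr_le.
Qed.

Lemma pr_setI1 A B : measurable A -> measurable B -> pr B = 1 ->
  pr (A `&` B) = pr A.
Proof.
move=> mA mB B1; rewrite (prID mA mB) (_ : pr (A `\` B) = 0) ?addr0//.
apply: (@pr_subset0 _ (~` B)); [exact: measurableD|exact: measurableC|by []|].
by rewrite prC// B1 subrr.
Qed.

End real_probability.

Section mpt_group.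
Context (R : realType) (d : measure_display) (X : measurableType d).
Variable P : probability X R.
Implicit Types (f g : invertible_mpt P) (A : set X).

Lemma measurable_mpt_preimage f A : measurable A -> measurable (f @^-1` A).
Proof.
by move=> mA; rewrite -[X in measurable X]setTI; exact: measurable_mpt_fun.
Qed.

Lemma measurable_mpt_inv_preimage f A :
  measurable A -> measurable (mpt_inv f @^-1` A).
Proof.
by move=> mA; rewrite -[X in measurable X]setTI; exact: measurable_mpt_inv.
Qed.

Lemma mpt_imageE f A : f @` A = mpt_inv f @^-1` A.
Proof.
apply/seteqP; split => [_ [x Ax <-]|y Ay] /=; first by rewrite mpt_funK.
by exists (mpt_inv f y) => //; rewrite mpt_invK.
Qed.

Lemma mpt_inv_preserving f A : measurable A -> P (mpt_inv f @^-1` A) = P A.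
Proof.
move=> mA; rewrite -(mpt_preserving f (measurable_mpt_inv_preimage f mA)).
by congr (P _); apply/seteqP; split=> x /=; rewrite mpt_funK.
Qed.

Definition mpt_inverse f : invertible_mpt P :=
  InvertibleMpt (@mpt_invK _ _ _ _ f) (@mpt_funK _ _ _ _ f)
    (measurable_mpt_inv f) (measurable_mpt_fun f) (@mpt_inv_preserving f).

Let mpt_id_preserving A : measurable A -> P (@id X @^-1` A) = P A.
Proof. by []. Qed.

Definition mpt_id : invertible_mpt P :=
  @InvertibleMpt _ _ _ P id id (fun=> erefl) (fun=> erefl)
    (@measurable_id _ _ _) (@measurable_id _ _ _) mpt_id_preserving.

Let mpt_comp_preserving f g A : measurable A -> P ((f \o g) @^-1` A) = P A.
Proof.
move=> mA; rewrite comp_preimage mpt_preserving; first exact: mpt_preserving.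
exact: measurable_mpt_preimage.
Qed.

Definition mpt_comp f g : invertible_mpt P :=
  @InvertibleMpt _ _ _ P (f \o g) (mpt_inv g \o mpt_inv f)
    (can_comp (@mpt_funK _ _ _ _ f) (@mpt_funK _ _ _ _ g))
    (can_comp (@mpt_invK _ _ _ _ g) (@mpt_invK _ _ _ _ f))
    (measurableT_comp (measurable_mpt_fun f) (measurable_mpt_fun g))
    (measurableT_comp (measurable_mpt_inv g) (measurable_mpt_inv f))
    (@mpt_comp_preserving f g).

Fixpoint mpt_iter f n : invertible_mpt P :=
  if n is m.+1 then mpt_comp f (mpt_iter f m) else mpt_id.

Lemma mpt_iterE f n x : mpt_iter f n x = iter n f x.
Proof. by elim: n => //= n ->. Qed.

Lemma pr_preimage f A : measurable A -> pr P (f @^-1` A) = pr P A.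
Proof. by move=> mA; rewrite /pr mpt_preserving. Qed.

Lemma pr_image f A : measurable A -> pr P (f @` A) = pr P A.
Proof. by move=> mA; rewrite /pr mpt_imageE mpt_inv_preserving. Qed.

End mpt_group.

(** * Gluing countably many transformations *)

Section piecewise.
Context (R : realType) (d : measure_display) (X : measurableType d).
Variable P : probability X R.
Variables (f f' : X -> X) (Z : nat -> set X) (g : nat -> invertible_mpt P).
Hypotheses (fK : cancel f f') (f'K : cancel f' f).
Hypotheses (mZ : forall k, measurable (Z k)) (tZ : trivIset setT Z).
Hypothesis ZT : \bigcup_k Z k = setT.
Hypothesis fg : forall k x, Z k x -> f x = g k x.

Let preimage_bigcup A : f @^-1` A = \bigcup_k (Z k `&` g k @^-1` A).
Proof.
apply/seteqP; split=> [x Afx|x [k _ [Zx /=]]]; last by rewrite -fg.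
have : (\bigcup_k Z k) x by rewrite ZT.
by case=> k _ Zx; exists k => //; split=> //=; rewrite -fg.
Qed.

Let image_bigcup A : f' @^-1` A = \bigcup_k (g k @` (Z k `&` A)).
Proof.
apply/seteqP; split=> [y /= Ay|_ [k _ [x [Zx Ax] <-]]] /=; last first.
  by rewrite -fg// fK.
have : (\bigcup_k Z k) (f' y) by rewrite ZT.
case=> k _ Zx; exists k => //; exists (f' y) => //.
by rewrite -(fg Zx) f'K.
Qed.

Let measurable_piecewise : measurable_fun setT f.
Proof.
move=> _ A mA; rewrite setTI preimage_bigcup; apply: bigcupT_measurable => k.
by apply: measurableI => //; exact: measurable_mpt_preimage.
Qed.

Let measurable_piecewise_inv : measurable_fun setT f'.
Proof.
move=> _ A mA; rewrite setTI image_bigcup; apply: bigcupT_measurable => k.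
by apply: measurable_mpt_image; exact: measurableI.
Qed.

(** Injectivity of [f] makes the images under [g k] of the pieces of $f^{-1}A$ disjoint, so they
    tile [A], and each [g k] preserves the measure of its own piece. *)
Let piecewise_preserving A : measurable A -> P (f @^-1` A) = P A.
Proof.
move=> mA; have mk k : measurable (g k @^-1` A) by exact: measurable_mpt_preimage.
have mi k : measurable (Z k `&` g k @^-1` A) by exact: measurableI.
have AE : A = \bigcup_k (g k @` (Z k `&` g k @^-1` A)).
  rewrite -[A in LHS](_ : f' @^-1` (f @^-1` A) = A); last first.
    by apply/seteqP; split=> x /=; rewrite f'K.
  rewrite image_bigcup; apply: eq_bigcupr => k _; congr (_ @` _).
  by apply/seteqP; split=> x /= [Zx]; rewrite (fg Zx).
rewrite preimage_bigcup [in RHS]AE !measure_semi_bigcup//.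
- apply: eq_eseriesr => k _.
  have := mpt_inv_preserving (g k) (mi k).
  by rewrite -mpt_imageE => /esym.
- by move=> k; exact: measurable_mpt_image.
- apply/trivIsetP => i j _ _ ij; apply/seteqP; split=> // y [] [x [Zx _] <-].
  case=> x' [Zx' _]; rewrite -(fg Zx) -(fg Zx') => /(can_inj fK) xx'.
  have : (Z i `&` Z j) x by split=> //; rewrite -xx'.
  by move/trivIsetP : tZ => ->.
- by apply: bigcupT_measurable => k; exact: measurable_mpt_image.
- apply/trivIsetP => i j _ _ ij.
  by move/trivIsetP : tZ => tZ'; rewrite setIACA tZ'// set0I.
- exact: bigcupT_measurable.
Qed.

Definition mpt_piecewise_nat : invertible_mpt P :=
  InvertibleMpt fK f'K measurable_piecewise measurable_piecewise_inv
    piecewise_preserving.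

End piecewise.

Lemma mpt_piecewise (R : realType) (d : measure_display) (X : measurableType d)
    (P : probability X R) (I : countType) (kappa : X -> I)
    (g : I -> invertible_mpt P) (f f' : X -> X) :
  cancel f f' -> cancel f' f -> (forall i, measurable [set x | kappa x = i]) ->
  (forall x, f x = g (kappa x) x) ->
  exists sigma : invertible_mpt P, sigma = f :> (X -> X).
Proof.
move=> fK f'K mkappa fg.
pose Z k := [set x | choice.pickle (kappa x) = k].
pose g' k := if choice.unpickle k is Some i then g i else mpt_id P.
have mZ k : measurable (Z k).
  case E : (@choice.pickle_inv I k) => [i|].
    rewrite (_ : Z k = [set x | kappa x = i])//.
    have /= pik : oapp choice.pickle k (@choice.pickle_inv I k) = k.
      exact: choice.pickle_invK.
    rewrite E /= in pik.
    apply/seteqP; split=> x; rewrite /Z /= -pik; last by move=> ->.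
    exact: (pcan_inj (@choice.pickleK I)).
  rewrite (_ : Z k = set0)//; apply/seteqP; split=> // x; rewrite /Z /= => xk.
  by move: E; rewrite -xk choice.pickleK_inv.
have tZ : trivIset setT Z by move=> i j _ _ [x [<- <-]].
have ZT : \bigcup_k Z k = setT.
  by apply/seteqP; split=> // x _; exists (choice.pickle (kappa x)).
have fg' k x : Z k x -> f x = g' k x.
  by rewrite /Z /g' /= => <-; rewrite choice.pickleK fg.
by exists (mpt_piecewise_nat fK f'K mZ tZ ZT fg').
Qed.

(** * Matching sets by powers of an ergodic transformation *)

Section ergodic_dynamics.
Context (R : realType) (d : measure_display) (X : measurableType d).
Variable P : probability X R.
Variable T : invertible_mpt P.
Local Notation pr := (pr P).

Lemma measurable_iter n (A : set X) :
  measurable A -> measurable [set x | A (iter n T x)].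
Proof.
move=> mA; rewrite (_ : [set x | _] = mpt_iter T n @^-1` A).
  exact: measurable_mpt_preimage.
by apply/seteqP; split=> x /=; rewrite mpt_iterE.
Qed.

Lemma pr_iter n (A : set X) :
  measurable A -> pr [set x | A (iter n T x)] = pr A.
Proof.
move=> mA; rewrite -(pr_preimage (mpt_iter T n) mA); congr (pr _).
by apply/seteqP; split=> x /=; rewrite mpt_iterE.
Qed.

(** The set [F] of points that ever visit [E] only satisfies $T^{-1}F \subseteq F$, whereas
    [ergodic] speaks of strictly invariant sets. The decreasing intersection [G] of the $T^{-n}F$ is
    strictly invariant, and it has the measure of [F] because every $T^{-n}F$ does. *)
Lemma ergodic_sweep (E : set X) : ergodic T -> measurable E -> 0 < pr E ->
  pr [set x | exists n, E (iter n T x)] = 1.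
Proof.
move=> ergT mE E0; set F := [set x | _].
have mF : measurable F.
  rewrite (_ : F = \bigcup_n [set x | E (iter n T x)]).
    by apply: bigcupT_measurable => n; exact: measurable_iter.
  by apply/seteqP; split=> x [n]; [exists n|move=> _ ?; exists n].
pose G := \bigcap_n [set x | F (iter n T x)].
have mFn n : measurable [set x | F (iter n T x)] by exact: measurable_iter.
have mG : measurable G by exact: bigcapT_measurable.
have FT x : F (T x) -> F x by case=> n; rewrite -iterSr; exists n.+1.
have FG : pr F = pr G.
  have niF : nonincreasing_seq (fun n => [set x | F (iter n T x)]).
    apply/nonincreasing_seqP => n; apply/subsetPset => x /=.
    exact: FT.
  have := pr_nonincreasing_cvg (P := P) mFn niF.
  rewrite (_ : (fun n => _) = fun=> pr F); last first.
    by apply/funext => n; exact: pr_iter.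
  by move=> cG; apply: (cvg_unique _ _ cG) => //; exact: cvg_cst.
have GT : T @^-1` G = G.
  apply/seteqP; split=> x /= Gx n _ /=.
    by apply: FT; have := Gx n I; rewrite /= -iterSr.
  by have := Gx n.+1 I; rewrite /= -iterS iterSr.
have EF : E `<=` F by move=> x Ex; exists 0%N.
have F0 : 0 < pr F by apply: lt_le_trans E0 _; exact: pr_le.
have [G0|G1] := ergT G mG GT; last by rewrite FG /pr G1.
by move: F0; rewrite FG /pr G0 ltxx.
Qed.

Section matching.
Variables (I : finType) (Q : X -> I) (A B : set X).
Hypothesis mQ : forall i, measurable [set x | Q x = i].
Hypotheses (mA : measurable A) (mB : measurable B) (AB : A `&` B = set0).

(** Times start at 1: the two sets to be matched are disjoint, so time 0 pairs nothing. *)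
Let hit n (A' B' : set X) : set X :=
  A' `&` [set x | B' (iter n.+1 T x) /\ Q (iter n.+1 T x) = Q x].

(* The parts of A and B left unmatched by the first n powers of T. *)
Let Fixpoint rest n : set X * set X :=
  if n is m.+1 then
    let a := hit m (rest m).1 (rest m).2 in
    ((rest m).1 `\` a, (rest m).2 `\` mpt_iter T m.+1 @` a)
  else (A, B).

Let a n := hit n (rest n).1 (rest n).2.
Let b n := mpt_iter T n.+1 @` a n.

Let mhit n A' B' : measurable A' -> measurable B' -> measurable (hit n A' B').
Proof.
move=> mA' mB'; apply: measurableI => //.
rewrite (_ : [set x | _] = \bigcup_(i in [set: I])
    ([set x | (B' `&` [set x | Q x = i]) (iter n.+1 T x)] `&` [set x | Q x = i])).
  apply: fin_bigcup_measurable => [|i _]; first exact: finite_finset.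
  by apply: measurableI => //; apply: measurable_iter; exact: measurableI.
apply/seteqP; split=> x /=; first by case=> B'x QT; exists (Q x).
by case=> i _ [[B'x ->] ->].
Qed.

Let mrest n : measurable (rest n).1 /\ measurable (rest n).2.
Proof.
elim: n => [//|n [m1 m2]] /=.
have mh := mhit n m1 m2.
by split; apply: measurableD => //; exact: (measurable_mpt_image (mpt_iter T n.+1)).
Qed.

Let ma n : measurable (a n). Proof. by apply: mhit; case: (mrest n). Qed.
Let mb n : measurable (b n). Proof. exact: measurable_mpt_image. Qed.

Let rest_mono m n : (m <= n)%N ->
  (rest n).1 `<=` (rest m).1 /\ (rest n).2 `<=` (rest m).2.
Proof.
elim: n => [|n IH]; first by rewrite leqn0 => /eqP ->; split.
rewrite leq_eqVlt => /predU1P[->|/IH[h1 h2]]; first by split.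
by split=> x /= [hx _]; [exact: h1|exact: h2].
Qed.

Let b_rest n : b n `<=` (rest n).2.
Proof. by move=> _ [x [_ [h _]] <-]; rewrite mpt_iterE. Qed.

Let a_inj m n x : a m x -> a n x -> m = n.
Proof.
wlog mn : m n / (m <= n)%N.
  by move=> H am an; case: (leqP m n) => [|/ltnW] h; [exact: H|exact/esym/H].
move: mn; rewrite leq_eqVlt => /predU1P[//|mn] am [an _].
by have [/(_ _ an)[]] := rest_mono mn.
Qed.

Let b_inj m n x : b m x -> b n x -> m = n.
Proof.
wlog mn : m n / (m <= n)%N.
  by move=> H am an; case: (leqP m n) => [|/ltnW] h; [exact: H|exact/esym/H].
move: mn; rewrite leq_eqVlt => /predU1P[//|mn] bm /b_rest bn.
by have [_ /(_ _ bn)[]] := rest_mono mn.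
Qed.

Let aA n : a n `<=` A.
Proof. by move=> x [/(rest_mono (leq0n n)).1]. Qed.

Let bB n : b n `<=` B.
Proof. by move=> x /b_rest/(rest_mono (leq0n n)).2. Qed.

Let ab m n x : a m x -> ~ b n x.
Proof. by move=> /aA Ax /bB Bx; have : (A `&` B) x by []; rewrite AB. Qed.

(** Records which power of [T] acts at [x]: $T^{n+1}$ on [a n] ([inl n]), $T^{-(n+1)}$ on [b n]
    ([inr n]), the identity on unmatched points. *)
Let kappa x : option (nat + nat) :=
  if pselect (exists n, a n x) is left h then Some (inl (projT1 (cid h)))
  else if pselect (exists n, b n x) is left h then Some (inr (projT1 (cid h)))
  else None.

Let kappa_a n x : kappa x = Some (inl n) <-> a n x.
Proof.
rewrite /kappa; case: pselect => [h|nh].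
  case: cid => m /= am; split; first by case=> <-.
  by move=> an; rewrite (a_inj am an).
by split=> [|an]; [case: pselect|exfalso; apply: nh; exists n].
Qed.

Let kappa_b n x : kappa x = Some (inr n) <-> b n x.
Proof.
rewrite /kappa; case: pselect => [[m am]|nh].
  by split=> [//|/(ab am)].
case: pselect => [h|nh'].
  case: cid => m /= bm; split; first by case=> <-.
  by move=> bn; rewrite (b_inj bm bn).
by split=> // bn; exfalso; apply: nh'; exists n.
Qed.

Let mkappa i : measurable [set x | kappa x = i].
Proof.
case: i => [[n|n]|].
- by rewrite (_ : [set x | _] = a n)//; apply/seteqP; split=> x /kappa_a.
- by rewrite (_ : [set x | _] = b n)//; apply/seteqP; split=> x /kappa_b.
- rewrite (_ : [set x | _] = ~` (\bigcup_n a n `|` \bigcup_n b n)).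
    by apply: measurableC; apply: measurableU; exact: bigcupT_measurable.
  apply/seteqP; split=> x /=.
    by move=> kx [[n _ /kappa_a]|[n _ /kappa_b]]; rewrite kx.
  case E : (kappa x) => [[n|n]|//] []; [left|right]; exists n => //.
    exact/kappa_a.
  exact/kappa_b.
Qed.

Let g (i : option (nat + nat)) : invertible_mpt P :=
  match i with
  | Some (inl n) => mpt_iter T n.+1
  | Some (inr n) => mpt_inverse (mpt_iter T n.+1)
  | None => mpt_id P
  end.

Let f x := g (kappa x) x.

Let f_a n x : a n x -> f x = mpt_iter T n.+1 x.
Proof. by rewrite /f => /kappa_a ->. Qed.

Let f_b n x : b n x -> f x = mpt_inv (mpt_iter T n.+1) x.
Proof. by rewrite /f => /kappa_b ->. Qed.

Let f_n x : kappa x = None -> f x = x.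
Proof. by rewrite /f => ->. Qed.

Let fK : involutive f.
Proof.
move=> x; case E : (kappa x) => [[n|n]|]; last by rewrite !f_n.
  have /kappa_a an := E; rewrite (f_a an).
  have bn : b n (mpt_iter T n.+1 x) by exists x.
  by rewrite (f_b bn) mpt_funK.
have /kappa_b [y an yx] := E; have bn : b n x by exists y.
by rewrite (f_b bn) -yx mpt_funK (f_a an).
Qed.

Let Qf x : Q (f x) = Q x.
Proof.
case E : (kappa x) => [[n|n]|]; last by rewrite f_n.
  by have /kappa_a an := E; rewrite (f_a an) mpt_iterE; case: an => _ [].
have /kappa_b [y an yx] := E; have bn : b n x by exists y.
rewrite (f_b bn) -yx mpt_funK mpt_iterE; by case: an => _ [].
Qed.

(** Greedy matching: at stage $n$, the remaining points of [A] that $T^{n+1}$ sends into the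
    remaining part of [B], inside the same cell, are swapped with their images. If the unmatched
    part of [B] in a cell has positive measure, almost every point visits it, and an unmatched point
    of [A] in that cell would have been paired at the time of that visit at the latest. So one of
    the two leftovers is null. *)
Lemma ergodic_matching : ergodic T ->
  exists sigma : invertible_mpt P,
    [/\ involutive sigma, forall x, Q (sigma x) = Q x,
        forall x, sigma x <> x -> A x /\ B (sigma x) \/ B x /\ A (sigma x) &
        forall i, pr [set x | [/\ A x, sigma x = x & Q x = i]] = 0 \/
                  pr [set x | [/\ B x, sigma x = x & Q x = i]] = 0].
Proof.
move=> ergT.
have [sigma sf] := mpt_piecewise fK fK mkappa (fun=> erefl _).
exists sigma; rewrite sf; split=> //.
- move=> x; case E : (kappa x) => [[n|n]|]; last by rewrite f_n.
  + have /kappa_a an := E; rewrite (f_a an) => _; left; split; first exact: aA an.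
    by apply: (@bB n); exists x.
  + have /kappa_b [y an yx] := E; have bn : b n x by exists y.
    rewrite (f_b bn) => _; right; split; first exact: bB bn.
    by rewrite -yx mpt_funK; exact: aA an.
move=> i.
pose Z := [set x | kappa x = None] `&` [set x | Q x = i].
have mZ : measurable Z by exact: measurableI.
have ZE (D : set X) : D `<=` A `|` B ->
    [set x | [/\ D x, f x = x & Q x = i]] = D `&` Z.
  move=> DAB; apply/seteqP; split=> x /=; last first.
    by case=> Dx [kx Qx]; split=> //; exact: f_n.
  case=> Dx fx Qx; split=> //; split=> //=.
  have : ~ (A x /\ B x) by move=> ABx; have : (A `&` B) x by []; rewrite AB.
  case E : (kappa x) => [[n|n]|//] nAB; exfalso; apply: nAB.
  + have /kappa_a an := E; split; first exact: aA an.
    by rewrite -fx (f_a an); apply: (@bB n); exists x.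
  + have /kappa_b [y an yx] := E; have bn : b n x by exists y.
    split; last exact: bB bn.
    by rewrite -fx (f_b bn) -yx mpt_funK; exact: aA an.
rewrite !ZE; [|by move=> x; right|by move=> x; left].
have mBZ : measurable (B `&` Z) by exact: measurableI.
have [|BZ0] := leP (pr (B `&` Z)) 0.
  by move=> BZ0; right; apply/eqP; rewrite eq_le BZ0 pr_ge0.
left; have S1 := ergodic_sweep ergT mBZ BZ0; move: S1; set S := [set x | _] => S1.
have mS : measurable S.
  rewrite (_ : S = \bigcup_n [set x | (B `&` Z) (iter n T x)]).
    by apply: bigcupT_measurable => n; exact: measurable_iter.
  by apply/seteqP; split=> x [n]; [exists n|move=> _ ?; exists n].
apply: (@pr_subset0 _ _ _ P _ (~` S)).
- exact: measurableI.
- exact: measurableC.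
- move=> x [Ax [kx Qx]] [[|n] [BTx [/= kTx QTx]]].
    by have : (A `&` B) x by []; rewrite AB.
  have lA m : (rest m).1 x.
    elim: m => [//|m IH]; split=> // ax.
    by have /kappa_a := ax; rewrite kx.
  have lB m : (rest m).2 (iter n.+1 T x).
    elim: m => [//|m IH]; split=> // bx.
    by have /kappa_b := bx; rewrite /= kTx.
  have : a n x by split=> //=; split; [exact: lB|rewrite QTx].
  by move/kappa_a; rewrite kx.
- by rewrite prC// S1 subrr.
Qed.

End matching.

(** Swap $C \setminus W$ with $W \setminus C$ as far as possible. In each cell one leftover is null:
    either all the mass of [C] has entered [W], or [W] is filled. *)
Lemma ergodic_fill (I : finType) (Q : X -> I) (C W : set X) :
  ergodic T -> (forall i, measurable [set x | Q x = i]) ->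
  measurable C -> measurable W ->
  exists2 sigma : invertible_mpt P, (forall x, Q (sigma x) = Q x) &
    forall i, Num.min (pr (C `&` [set x | Q x = i])) (pr (W `&` [set x | Q x = i]))
      <= pr (sigma @` C `&` W `&` [set x | Q x = i]).
Proof.
move=> ergT mQ mC mW.
have mCW : measurable (C `\` W) by exact: measurableD.
have mWC : measurable (W `\` C) by exact: measurableD.
have CW : (C `\` W) `&` (W `\` C) = set0.
  by apply/seteqP; split=> // x [[? ?] []].
have [sigma [sK sQ sAB s0]] := ergodic_matching mQ mCW mWC CW ergT.
exists sigma => // i; set q := [set x | Q x = i].
have sC x : (sigma @` C) x <-> C (sigma x).
  by split=> [[y Cy <-]|Cx]; [rewrite sK|exists (sigma x)].
have mD : measurable (sigma @` C) by exact: measurable_mpt_image.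
have mq : measurable q by exact: mQ.
have mDq : measurable (sigma @` C `&` q) by exact: measurableI.
have mWq : measurable (W `&` q) by exact: measurableI.
have hA : sigma @` C `&` q `\` W = [set x | [/\ (C `\` W) x, sigma x = x & Q x = i]].
  apply/seteqP; split=> x /=.
    case=> -[/sC Csx Qx] nWx; have [sx|/eqP sx] := eqVneq (sigma x) x.
      by split=> //; rewrite sx in Csx.
    by have [[_ []]|[[]]] := sAB x sx.
  by case=> -[Cx nWx] sx Qx; split=> //; split=> //; apply/sC; rewrite sx.
have hB : W `&` q `\` (sigma @` C) =
    [set x | [/\ (W `\` C) x, sigma x = x & Q x = i]].
  apply/seteqP; split=> x /=.
    case=> -[Wx Qx] nCx; have [sx|/eqP sx] := eqVneq (sigma x) x.
      by split=> //; split=> // Cx; apply: nCx; apply/sC; rewrite sx.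
    have [[[_ nW]]//|[_ [Csx _]]] := sAB x sx.
    by exfalso; apply: nCx; apply/sC.
  by case=> -[Wx nCx] sx Qx; split=> // /sC; rewrite sx.
have eA : pr (C `&` q) = pr (sigma @` C `&` W `&` q) + pr (sigma @` C `&` q `\` W).
  rewrite -setIA (setIC W) setIA -(prID P mDq mW) -(pr_image sigma); last exact: measurableI.
  congr (pr _); apply/seteqP; split=> x /=.
    by case=> y [Cy Qy] <-; split; [exists y|rewrite /q /= sQ].
  by case=> -[y Cy <-]; rewrite /q /= sQ => Qy; exists y.
have eB : pr (W `&` q) = pr (sigma @` C `&` W `&` q) + pr (W `&` q `\` (sigma @` C)).
  by rewrite (setIC (sigma @` C)) setIAC -prID.
rewrite ge_min; have [h|h] := s0 i.
  by apply/orP; left; rewrite eA hA h addr0.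
by apply/orP; right; rewrite eB hB h addr0.
Qed.

End ergodic_dynamics.

(** * Almost invariant sets of measure one half *)

(** Random signs attain the bound on average; here they are fixed one vector at a time. The
    coordinates [i] will be the cells of [Q] and the vectors the pieces of a fine partition, so that
    one selection of pieces halves every cell. *)
Lemma sign_balancing (R : realDomainType) (J I : finType) (v : J -> I -> R) :
  exists s : J -> bool,
    \sum_i (\sum_j (-1) ^+ s j * v j i) ^+ 2 <= \sum_j \sum_i v j i ^+ 2.
Proof.
suff [s hs] : exists s : J -> bool,
    \sum_i (\sum_(j <- enum J) (-1) ^+ s j * v j i) ^+ 2 <=
    \sum_(j <- enum J) \sum_i v j i ^+ 2.
  exists s; rewrite [leRHS]big_enum in hs; apply: le_trans _ hs.
  by under [leRHS]eq_bigr do rewrite big_enum.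
elim: (enum J) (enum_uniq J) => [_|j js IH /= /andP[jjs /IH[s hs]]].
  by exists (fun=> false); rewrite big_nil big1// => i _; rewrite big_nil expr0n.
pose S i := \sum_(k <- js) (-1) ^+ s k * v k i.
(* The sign of j makes the cross term with the previous partial sums <= 0. *)
pose e := 0 < \sum_i S i * v j i.
exists (fun k => if k == j then e else s k).
have SE i : \sum_(k <- j :: js) (-1) ^+ (if k == j then e else s k) * v k i =
    (-1) ^+ e * v j i + S i.
  rewrite big_cons eqxx; congr (_ + _); apply: eq_big_seq => k kjs.
  by case: eqP => // kj; rewrite -kj kjs in jjs.
under eq_bigr do rewrite SE.
rewrite big_cons.
have -> : \sum_i ((-1) ^+ e * v j i + S i) ^+ 2 = \sum_i v j i ^+ 2 +
    (-1) ^+ e * (\sum_i S i * v j i) *+ 2 + \sum_i S i ^+ 2.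
  rewrite -mulrnAr -sumrMnl mulr_sumr -!big_split; apply: eq_bigr => i _ /=.
  rewrite sqrrD exprMn -exprM mulnC exprM sqrrN expr1n expr1n mul1r.
  by rewrite mulrnAr -mulrA (mulrC (v j i)).
apply: lerD hs; rewrite gerDl mulrn_wle0//.
rewrite /e; have [S0|S0] := ltP 0 (\sum_i S i * v j i); first by rewrite mulr_sign oppr_le0 ltW.
by rewrite mulr_sign.
Qed.

Section almost_invariant_set.
Context (R : realType) (d : measure_display) (X : measurableType d).
Variable P : probability X R.
Variable T : invertible_mpt P.
Local Notation pr := (pr P).

Section first_hit.
Variables (J : Type) (p : X -> J) (E : set X).

(** Value of [p] at the first visit to [E] among the times less than [K]. Off [E] this value passes
    from [x] to $Tx$, so a union of sets where it is prescribed can be left only through [E]; this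
    does the work of a Rokhlin tower. *)
Fixpoint first_hit K x : option J :=
  if K is k.+1 then
    if `[< E x >] then Some (p x) else first_hit k (T x)
  else None.

Lemma first_hitS K x j : first_hit K x = Some j -> first_hit K.+1 x = Some j.
Proof.
elim: K x => [//|K IH] x; rewrite [first_hit K.+1 x]/= [first_hit K.+2 x]/=.
by case: ifP => // _ /IH.
Qed.

Lemma first_hit_invariant K x j : ~ E x ->
  first_hit K x = Some j -> first_hit K (T x) = Some j.
Proof.
case: K => [//|K] nEx /=; rewrite asboolF// => h.
exact: first_hitS.
Qed.

Lemma first_hit_none K x :
  first_hit K x = None <-> forall n, (n < K)%N -> ~ E (iter n T x).
Proof.
elim: K x => [//|K IH] x /=; case: asboolP => Ex.
  by split=> // /(_ 0%N erefl).
rewrite IH; split=> h [|n] nK.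
- by [].
- by rewrite iterSr; exact: h.
- by rewrite -iterSr; exact: h.
- by rewrite -iterSr; exact: h.
Qed.

Hypothesis mE : measurable E.
Hypothesis mp : forall j, measurable [set x | p x = j].

Lemma measurable_first_hit K o : measurable [set x | first_hit K x = o].
Proof.
elim: K => [|K IH].
  case: o => [j|].
    by rewrite (_ : [set x | _] = set0)//; apply/seteqP; split.
  by rewrite (_ : [set x | _] = setT)//; apply/seteqP; split.
rewrite (_ : [set x | _] = (E `&` [set x | Some (p x) = o]) `|`
    (~` E `&` T @^-1` [set x | first_hit K x = o])).
  apply: measurableU; apply: measurableI => //.
  - case: {IH} o => [j|]; last by rewrite (_ : [set x | _] = set0)//; apply/seteqP; split.
    rewrite (_ : [set x | _] = [set x | p x = j])//.
    by apply/seteqP; split=> x /= => [[]|->].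
  - exact: measurableC.
  - exact: measurable_mpt_preimage.
apply/seteqP; split=> x /=; case: asboolP => Ex; try by [left|right].
  by case=> [[_ //]|[]].
by case=> [[]//|[_ //]].
Qed.

(** Union bound over the [K] possible times of the visit. Once [K] is fixed, refining [p] makes all
    first-visit pieces small. *)
Lemma pr_first_hit_some K j :
  pr [set x | first_hit K x = Some j] <= K%:R * pr [set x | p x = j].
Proof.
elim: K => [|K IH].
  by rewrite mul0r (_ : [set x | _] = set0) ?pr0//; apply/seteqP; split.
have mK : measurable (T @^-1` [set x | first_hit K x = Some j]).
  by apply: measurable_mpt_preimage; exact: measurable_first_hit.
apply: (@le_trans _ _ (pr ([set x | p x = j] `|`
    T @^-1` [set x | first_hit K x = Some j]))).
  apply: pr_le; [exact: measurable_first_hit|exact: measurableU|].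
  by move=> x /=; case: ifP => _ => [[]|]; [left|right].
apply: le_trans (prU2 P (mp j) mK) _.
rewrite pr_preimage; last exact: measurable_first_hit.
by rewrite -[in leRHS]natr1 mulrDl mul1r addrC lerD2r.
Qed.

Lemma pr_first_hit_none : ergodic T -> 0 < pr E ->
  pr [set x | first_hit K x = None] @[K --> \oo] --> (0 : R).
Proof.
move=> ergT E0; have S1 := ergodic_sweep ergT mE E0.
move: S1; set S := [set x | _] => S1.
have mN K := measurable_first_hit K None.
have -> : 0 = pr (\bigcap_K [set x | first_hit K x = None]).
  rewrite (_ : \bigcap_K _ = ~` S).
    rewrite prC ?S1 ?subrr//.
    rewrite (_ : S = ~` (\bigcap_K [set x | first_hit K x = None])).
      by apply: measurableC; exact: bigcapT_measurable.
    apply/seteqP; split=> x.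
      by move=> [n Ex] /(_ n.+1 I) /first_hit_none/(_ n (ltnSn n)).
    apply: contra_notP => nS K _; apply/first_hit_none => n _ Ex.
    by apply: nS; exists n.
  apply/seteqP; split=> x.
    by move=> h [n Ex]; have /first_hit_none/(_ n (ltnSn n)) := h n.+1 I.
  by move=> nS K _; apply/first_hit_none => n _ Ex; apply: nS; exists n.
apply: pr_nonincreasing_cvg => //.
apply/nonincreasing_seqP => n; apply/subsetPset => x /first_hit_none h.
by apply/first_hit_none => m mn; apply: h; rewrite ltnW.
Qed.

End first_hit.

(** Non-atomicity, in the form in which it is used; the construction of $W$ needs nothing else from
    the Lebesgue space. *)
Definition finely_divisible := forall e : R, 0 < e ->
  exists (n : nat) (p : X -> 'I_n),
    (forall j, measurable [set x | p x = j]) /\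
    forall j, pr [set x | p x = j] <= e.

Hypothesis fine_P : finely_divisible.

Lemma small_positive_set (e : R) : 0 < e ->
  exists E, [/\ measurable E, 0 < pr E & pr E <= e].
Proof.
move=> /fine_P[n [p [mp pe]]].
have /existsP[j pj] : [exists j, 0 < pr [set x | p x = j]].
    apply/existsP; apply: contrapT => /forallNP p0.
  have := pr_label P mp xpredT (@measurableT _ X).
  rewrite (_ : _ `&` _ = setT); last by apply/seteqP; split.
  rewrite prT big1 => [/eqP|j _]; first by rewrite oner_eq0.
  by apply/eqP; rewrite setTI eq_le pr_ge0 andbT leNgt; apply/negP/p0.
by exists [set x | p x = j]; split.
Qed.

(** The order of choices matters: first [E], then a horizon [K] by which all but [e] of the space
    has met [E], then a partition [p] so fine for this [K] that each first-visit piece has measure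
    at most $e^2$. Signs balance the pieces in all cells simultaneously, and [W] is the union of the
    pieces of positive sign. *)
Lemma almost_invariant_half (I : finType) (Q : X -> I) (e : R) :
  ergodic T -> (forall i, measurable [set x | Q x = i]) -> 0 < e ->
  exists W E, [/\ measurable W, measurable E, pr E <= e,
    forall x, W x -> ~ E x -> W (T x) &
    forall i, `|pr (W `&` [set x | Q x = i]) - pr [set x | Q x = i] / 2| <= e].
Proof.
move=> ergT mQ e0.
have [E [mE E0 Ee]] := small_positive_set e0.
have [n0 [p0 [mp0 _]]] := fine_P e0.
(* Missing [E] before time [K] is an event that does not involve [p], so [K] can be fixed before the
   partition; [p0] only serves to express that event. *)
have [K hK] : exists K, forall (J : Type) (p : X -> J),
    pr [set x | first_hit p E K x = None] <= e.
  have /cvgrPdist_le/(_ e e0)[K _ /(_ K (leqnn K))] :=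
    pr_first_hit_none mE mp0 ergT E0.
  rewrite sub0r normrN ger0_norm ?pr_ge0// => hK; exists K => J p.
  rewrite (_ : [set x | _] = [set x | first_hit p0 E K x = None])//.
  by apply/seteqP; split=> x /first_hit_none h; apply/first_hit_none.
have tau0 : 0 < e ^+ 2 / K.+1%:R by rewrite divr_gt0// exprn_gt0.
have [n [p [mp ptau]]] := fine_P tau0.
pose L := first_hit p E K.
have mL o : measurable [set x | L x = o] by exact: measurable_first_hit.
pose v (j : 'I_n) i := pr ([set x | Q x = i] `&` [set x | L x = Some j]).
have [s hs] := sign_balancing v.
have Lsmall j : pr [set x | L x = Some j] <= e ^+ 2.
  apply: le_trans (pr_first_hit_some mE mp _ _) _.
  apply: (@le_trans _ _ (K.+1%:R * (e ^+ 2 / K.+1%:R))); last first.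
    by rewrite mulrCA divff ?mulr1.
  by apply: ler_pM => //; [exact: pr_ge0|rewrite ler_nat].
(* Each entry is at most $e^2$ and all entries together have mass at most 1, hence the sum of
   squares is at most $e^2$. *)
have sumv : \sum_j \sum_i v j i ^+ 2 <= e ^+ 2.
  apply: (@le_trans _ _ (\sum_j \sum_i v j i * e ^+ 2)).
    apply: ler_sum => j _; apply: ler_sum => i _; rewrite expr2.
    apply: ler_wpM2l; first exact: pr_ge0.
    apply: le_trans _ (Lsmall j); apply: pr_le => //.
    exact: measurableI.
  under eq_bigr do rewrite -mulr_suml.
  rewrite -mulr_suml ger_pMl ?exprn_gt0//.
  have -> : \sum_j \sum_i v j i = \sum_(o | isSome o) pr [set x | L x = o].
    rewrite [RHS](@reindex_omap _ _ _ _ _ Some id) => [|[]//] /=.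
    rewrite [RHS](eq_bigl xpredT) => [|j]; last by rewrite eqxx.
    apply: eq_bigr => j _.
    have := pr_label P mQ xpredT (mL (Some j)).
    rewrite (_ : _ `&` [set x | is_true true] = [set x | L x = Some j]); last first.
      by apply/seteqP; split=> x // [].
    by move=> ->; apply: eq_bigr => i _; rewrite setIC.
  have := pr_label P mL isSome (@measurableT _ X).
  under eq_bigr do rewrite setTI.
  rewrite setTI => <-; apply: pr_le1.
  exact: (measurable_label mL isSome).
have vs i : `|\sum_j (-1) ^+ s j * v j i| <= e.
  rewrite -(@ler_pXn2r _ 2) ?nnegrE ?(ltW e0)// real_normK ?num_real//.
  apply: le_trans _ sumv; apply: le_trans _ hs.
  by rewrite (bigD1 i)//= lerDl; apply: sumr_ge0 => ? _; exact: sqr_ge0.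
pose w o := if o is Some j then ~~ s j else false.
pose W := [set x | w (L x)].
have mW : measurable W by exact: (measurable_label mL w).
exists W, E; split=> //.
  move=> x; rewrite /W /= /w; case E1 : (L x) => [j|//] sj nEx.
  by rewrite /L (first_hit_invariant nEx E1).
move=> i.
have mq : measurable [set x | Q x = i] by [].
have qW : pr (W `&` [set x | Q x = i]) = \sum_(j | ~~ s j) v j i.
  rewrite setIC (pr_label P mL w mq).
  rewrite (@reindex_omap _ _ _ _ _ Some id) => [|[]//] /=.
  by apply: eq_bigl => j; rewrite eqxx andbT.
have qN : pr [set x | Q x = i] - \sum_j v j i =
    pr ([set x | Q x = i] `&` [set x | L x = None]).
  have := pr_label P mL xpredT mq.
  rewrite (_ : _ `&` [set x | is_true true] = [set x | Q x = i]); last first.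
    by apply/seteqP; split=> x // [].
  rewrite (bigD1 None)//= => ->.
  rewrite [X in _ + X - _](@reindex_omap _ _ _ _ _ Some id) => [|[]//] /=.
  rewrite [X in _ + X - _](_ : _ = \sum_j v j i) ?addrK//.
  by apply: eq_bigl => j; rewrite eqxx.
(* The signed sum is twice the mass of [W] in the cell minus the mass of the cell that meets [E] in
   time. The part that does not is at most [e], so twice the imbalance is at most $2e$. *)
have sv : \sum_j (-1) ^+ s j * v j i = 2 * (\sum_(j | ~~ s j) v j i) - \sum_j v j i.
  rewrite [in RHS](bigID (fun j => ~~ s j) predT)/= [in LHS](bigID (fun j => ~~ s j) predT)/=.
  rewrite (eq_bigr (fun j => v j i)) => [|j /negbTE ->]; last by rewrite mulr_sign.
  rewrite [X in _ + X](eq_bigr (fun j => - v j i)) => [|j]; last first.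
    by rewrite negbK => ->; rewrite mulr_sign.
  rewrite sumrN; ring.
have := vs i; rewrite sv -qW.
have : pr ([set x | Q x = i] `&` [set x | L x = None]) <= e.
  apply: le_trans _ (hK _ p); apply: pr_le => //.
  exact: measurableI.
have := pr_ge0 P ([set x | Q x = i] `&` [set x | L x = None]).
rewrite -qN !ler_norml; lra.
Qed.

End almost_invariant_set.

(** * Entropy *)

Lemma limn_esup_ge (R : realType) (u : (\bar R)^nat) (l : \bar R) :
  (\forall n \near \oo, l <= u n)%E -> (l <= limn_esup u)%E.
Proof.
move=> lu; apply: le_ereal_inf_tmp => _ [V FV <-].
have [n [Vn ln]] := filter_ex (filterI FV lu).
by apply: le_trans ln _; apply: ereal_sup_ubound; exists n.
Qed.

Lemma limn_einf_le (R : realType) (u : (\bar R)^nat) (l : \bar R) :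
  (\forall n \near \oo, u n <= l)%E -> (limn_einf u <= l)%E.
Proof.
move=> ul; rewrite /limn_einf leeNl; apply: limn_esup_ge.
by apply: filterS ul => n /=; rewrite leeN2.
Qed.

Section gibbs.
Context (R : realType).

Lemma ln_le_sub1 (x : R) : 0 < x -> ln x <= x - 1.
Proof.
move=> x0; rewrite -[in leLHS](subrKC 1 x); apply: le_ln1Dx; lra.
Qed.

Lemma ln_prod (I : Type) (s : seq I) (F : I -> R) : (forall i, 0 < F i) ->
  ln (\prod_(i <- s) F i) = \sum_(i <- s) ln (F i).
Proof.
move=> F0; elim: s => [|i s IH]; first by rewrite !big_nil ln1.
by rewrite !big_cons lnM ?IH ?posrE//; exact: prodr_gt0.
Qed.

(** Termwise $\ln x \le x - 1$ at $x = r/p$; where $p$ vanishes the logarithmic terms are 0 and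
    positivity of $r$ suffices. *)
Lemma gibbs (B : finType) (p r : B -> R) :
  (forall b, 0 <= p b) -> (forall b, 0 < r b) -> \sum_b r b <= \sum_b p b ->
  \sum_b p b * ln (r b) <= \sum_b p b * ln (p b).
Proof.
move=> p0 r0 rp.
suff : \sum_b p b * ln (r b) <= \sum_b (p b * ln (p b) + (r b - p b)).
  rewrite big_split sumrB /=; lra.
apply: ler_sum => b _; have [pb|pb] := eqVneq (p b) 0.
  by rewrite pb !mul0r add0r subr0 ltW.
have pb0 : 0 < p b by rewrite lt_neqAle eq_sym pb p0.
have := ler_wpM2l (p0 b) (ln_le_sub1 (divr_gt0 (r0 b) pb0)).
rewrite ln_div ?posrE// !mulrBr mulr1 mulrCA divff ?mulr1//; lra.
Qed.

End gibbs.

Section entropy.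
Context (R : realType) (d : measure_display) (X : measurableType d).
Variable P : probability X R.
Local Notation pr := (pr P).

Definition pattern (S : nat -> set X) n x : {ffun 'I_n -> bool} :=
  [ffun i : 'I_n => `[< S i x >]].

Lemma measurable_pattern S n (b : {ffun 'I_n -> bool}) :
  (forall i, measurable (S i)) -> measurable [set x | pattern S n x = b].
Proof.
move=> mS.
rewrite (_ : [set x | _] =
    \bigcap_(i in [set: 'I_n]) (if b i then S i else ~` S i)).
  apply: fin_bigcap_measurable => [|i _]; first exact: finite_finset.
  by case: ifP => _; [|exact: measurableC].
apply/seteqP; split=> x.
  by move=> <- i _; rewrite ffunE; case: asboolP.
move=> h; apply/ffunP => i; rewrite ffunE; have := h i I.
by case: ifP => _ Sx; [exact: asboolT|exact: asboolF].
Qed.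

Lemma join_partitionE S n :
  join_partition S n = [set [set x | pattern S n x = b] | b in setT].
Proof.
have E (b : nat -> bool) : \bigcap_(i in `I_n) (if b i then S i else ~` S i) =
    [set x | pattern S n x = [ffun i : 'I_n => b i]].
  apply/seteqP; split=> x.
    move=> h; apply/ffunP => i; rewrite !ffunE; have := h i (ltn_ord i).
    by case: (b i) => Sx; [exact: asboolT|exact: asboolF].
  move=> h i ni.
  have := congr1 (fun f : {ffun 'I_n -> bool} => f (Ordinal ni)) h.
  rewrite !ffunE /= => <-.
  by case: asboolP.
apply/seteqP; split=> A [b _ <-].
  by exists [ffun i : 'I_n => b i].
pose b' i := if insub i is Some j then b j else false.
exists b' => //; rewrite E (_ : [ffun i : 'I_n => b' i] = b)//.
by apply/ffunP => i; rewrite ffunE /b' valK.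
Qed.

(** The join is a set of sets, so equal cells count once, while patterns are summed with repetition.
    Distinct patterns share a cell only when it is empty, and an empty cell contributes 0. *)
Lemma partition_entropy_joinE S n :
  partition_entropy P (join_partition S n) =
  - \sum_(b : {ffun 'I_n -> bool})
      pr [set x | pattern S n x = b] * log2 (pr [set x | pattern S n x = b]).
Proof.
rewrite /partition_entropy join_partitionE; congr (- _).
pose cell b := [set x | pattern S n x = b].
pose F A := pr A * log2 (pr A).
have F0 : F set0 = 0 by rewrite /F pr0 mul0r.
rewrite -(fsbig_widen (cell @` [set b | cell b !=set0]) (cell @` setT)); last 2 first.
- by move=> _ [b _ <-]; exists b.
- move=> _ [[b _ <-] nb].
  have [cb|/nonemptyPn cb0] := pselect (cell b !=set0).
    by exfalso; apply: nb; exists b.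
  have : F (cell b) = 0 by rewrite cb0.
  by [].
rewrite fsbig_image; last first.
  by move=> b b' /set_mem[x bx] _ cbb'; move: (bx); rewrite cbb' => <-.
rewrite (fsbig_widen _ setT)//; last first.
  move=> b [_ /= /nonemptyPn cb0].
  have : F (cell b) = 0 by rewrite cb0.
  by [].
rewrite -[RHS]big_enum [RHS]fsbig_seq ?enum_uniq//; apply: eq_fsbigl.
by apply/seteqP; split=> // b _ /=; rewrite mem_enum.
Qed.

(** The entropy is at most the cross entropy with respect to the mixture [r]. Keeping in [r] only
    the term of the actual label costs $\ln |I|$; each coordinate then costs $-\ln(1-c)$ when
    predicted correctly and $-\ln c$ when not, which has probability at most [c]. *)
Lemma join_entropy_bound (I : finType) (Q : X -> I) (S : nat -> set X)
    (s : nat -> I -> bool) (c : R) n :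
  (0 < #|I|)%N -> (forall i, measurable [set x | Q x = i]) ->
  (forall i, measurable (S i)) -> 0 < c -> c < 1 ->
  (forall i, pr [set x | `[< S i x >] != s i (Q x)] <= c) ->
  - \sum_(b : {ffun 'I_n -> bool})
      pr [set x | pattern S n x = b] * ln (pr [set x | pattern S n x = b])
  <= ln #|I|%:R + n%:R * (- ln (1 - c) - c * ln c).
Proof.
move=> I0 mQ mS c0 c1 hs.
have K0 : 0 < #|I|%:R :> R by rewrite ltr0n.
pose w (i : 'I_n) q (b : bool) : R := if b == s i q then 1 - c else c.
have w0 i q b : 0 < w i q b by rewrite /w; case: ifP => _ //; lra.
(* Law of the pattern when Q is uniform and each bit is, independently given Q,
   equal to its prediction s i (Q x) with probability 1 - c. *)
pose r (b : {ffun 'I_n -> bool}) := #|I|%:R^-1 * \sum_q \prod_i w i q (b i).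
have prod0 (b : {ffun 'I_n -> bool}) q : 0 < \prod_i w i q (b i).
  by apply: prodr_gt0 => i _.
have r_ge (b : {ffun 'I_n -> bool}) q : #|I|%:R^-1 * \prod_i w i q (b i) <= r b.
  rewrite /r ler_pM2l ?invr_gt0// (bigD1 q)//= lerDl.
  by apply: sumr_ge0 => q' _; exact: ltW.
have r0 b : 0 < r b.
  have /card_gt0P[q _] := I0.
  by apply: lt_le_trans (r_ge b q); rewrite mulr_gt0 ?invr_gt0.
have lnr (b : {ffun 'I_n -> bool}) q : \sum_i ln (w i q (b i)) - ln #|I|%:R <= ln (r b).
  rewrite -ln_prod// -ln_div ?posrE// ler_ln ?posrE ?divr_gt0// mulrC.
  exact: r_ge.
have sumr1 : \sum_b r b = 1.
  rewrite -mulr_sumr exchange_big /=.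
  rewrite (eq_bigr (fun=> 1)) => [|q _].
    by rewrite sumr_const mulVf// gt_eqF.
  rewrite -(bigA_distr_bigA (fun i => w i q)) big1// => i _.
  by rewrite big_bool /w; case: (s i q) => /=; lra.
pose Y x := (pattern S n x, Q x).
have mY z : measurable [set x | Y x = z].
  rewrite (_ : [set x | _] = [set x | pattern S n x = z.1] `&` [set x | Q x = z.2]).
    by apply: measurableI => //; exact: measurable_pattern.
  by apply/seteqP; split=> x; case: z => a b; rewrite /Y /= => [] [-> ->].
pose p z := pr [set x | Y x = z].
have pE b : pr [set x | pattern S n x = b] = \sum_q p (b, q).
  have := pr_label P mQ xpredT (@measurable_pattern S n b mS).
  rewrite (_ : _ `&` [set x | is_true true] = [set x | pattern S n x = b]); last first.
    by apply/seteqP; split=> x // [].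
  move=> ->; apply: eq_bigr => q _; congr pr.
  by apply/seteqP; split=> x; rewrite /Y /= => [] [-> ->].
have prY (a : pred ({ffun 'I_n -> bool} * I)) :
    pr [set x | a (Y x)] = \sum_(z | a z) p z.
  have := pr_label P mY a (@measurableT _ X); rewrite setTI => ->.
  by apply: eq_bigr => z _; rewrite setTI.
have sump : \sum_z p z = 1.
  by rewrite -(prY xpredT) -(prT P); congr pr; apply/seteqP; split.
have sumpb : \sum_b pr [set x | pattern S n x = b] = 1.
  by under eq_bigr do rewrite pE; rewrite pair_bigA /= -sump; apply: eq_bigr => -[].
have Sb (f : {ffun 'I_n -> bool} -> R) :
    \sum_b pr [set x | pattern S n x = b] * f b = \sum_z p z * f z.1.
  under eq_bigr do rewrite pE mulr_suml.
  by rewrite pair_bigA /=; apply: eq_bigr => -[].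
rewrite lerNl; apply: le_trans (gibbs _ r0 _); last 2 first.
- by move=> b; exact: pr_ge0.
- by rewrite sumr1 sumpb.
rewrite (Sb (fun b => ln (r b))).
apply: (@le_trans _ _ (\sum_z p z * (\sum_i ln (w i z.2 (z.1 i)) - ln #|I|%:R))); last first.
  by apply: ler_sum => z _; apply: ler_wpM2l => //; exact: pr_ge0.
under eq_bigr do rewrite mulrBr mulr_sumr.
rewrite sumrB -mulr_suml sump mul1r exchange_big /= opprD addrC lerD2r.
have -> : - (n%:R * (- ln (1 - c) - c * ln c)) = \sum_(i < n) (ln (1 - c) + c * ln c).
  by rewrite sumr_const card_ord -mulr_natl; ring.
apply: ler_sum => i _.
pose bad (z : {ffun 'I_n -> bool} * I) := z.1 i != s i z.2.
rewrite (bigID bad)/=.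
pose t := \sum_(z | bad z) p z.
have tc : t <= c.
  rewrite /t -prY; apply: le_trans _ (hs i); rewrite le_eqVlt; apply/orP; left.
  by apply/eqP; congr pr; apply/seteqP; split=> x; rewrite /bad /Y /= ffunE.
have -> : \sum_(z | bad z) p z * ln (w i z.2 (z.1 i)) = t * ln c.
  by rewrite /t mulr_suml; apply: eq_bigr => z /negbTE h; rewrite /w h.
have -> : \sum_(z | ~~ bad z) p z * ln (w i z.2 (z.1 i)) =
    (1 - t) * ln (1 - c).
  have -> : 1 - t = \sum_(z | ~~ bad z) p z.
    by have := sump; rewrite (bigID bad)/= -/t; lra.
  by rewrite mulr_suml; apply: eq_bigr => z; rewrite negbK => h; rewrite /w h.
have t0 : 0 <= t by apply: sumr_ge0 => z _; exact: pr_ge0.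
have lnc : ln c <= 0 by have := ln_le_sub1 c0; lra.
have c1' : 0 < 1 - c by lra.
have lnc1 : ln (1 - c) <= 0 by have := ln_le_sub1 c1'; lra.
(* Both logarithms are nonpositive, so the weights $t \le c$ and $1 - t \le 1$ may be raised to $c$
   and 1. *)
nra.
Qed.

Lemma family_entropy_separation (C : set (set X)) :
  C `<=` measurable -> (0 < family_entropy P C)%E ->
  exists2 c : R, 0 < c &
    forall (I : finType) (Q : X -> I), (forall i, measurable [set x | Q x = i]) ->
    exists2 A, C A & forall s : I -> bool,
      c < pr [set x | `[< A x >] != s (Q x)].
Proof.
move=> mC; rewrite /family_entropy => H0.
have ln2 : 0 < ln 2 :> R by apply: ln_gt0; lra.
(* The rate $5t$ splits into $4t$ for prediction errors of measure $t^2$ and one $t$ that absorbs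
   $\ln|I|/n$ for large $n$; [ln 2] converts to base 2. For finite entropy the denominator 6 in [u]
   makes the inequality strict. *)
have [t [t0 t1 tH]] : exists t : R, [/\ 0 < t, t <= 1 / 2 &
    ((5 * t / ln 2)%:E < ereal_sup
      [set sequence_entropy P S | S in [set S | forall i, C (S i)]])%E].
  move: H0; case: (ereal_sup _) => [h|_|//]; last first.
    by exists (1 / 2); split; [lra|lra|rewrite ltry].
  rewrite lte_fin => h0.
  pose u := h * ln 2 / 6.
  have u0 : 0 < u by rewrite /u divr_gt0// mulr_gt0.
  exists (Num.min (1 / 2) u); split.
  - by rewrite lt_min u0 andbT; lra.
  - by rewrite ge_min lexx.
  - rewrite lte_fin ltr_pdivrMr//.
    have : Num.min (1 / 2) u <= u by rewrite ge_min lexx orbT.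
    have -> : h * ln 2 = 6 * u by rewrite /u; field.
    lra.
(* Squared because $-c \ln c$ is not bounded by a multiple of $c$; for $c = t^2$ it is at most
   $2t$. *)
exists (t ^+ 2); first exact: exprn_gt0.
move=> I Q mQ; apply: contrapT => /forall2NP hQ.
have hA A : C A -> exists s : I -> bool,
    pr [set x | `[< A x >] != s (Q x)] <= t ^+ 2.
  move=> CA; have [//|/existsNP[s /negP]] := hQ A; rewrite -leNgt => hs.
  by exists s.
move: tH; rewrite ltNge => /negP; apply.
apply: ge_ereal_sup => _ [S CS <-].
have [s hs] : exists s : nat -> I -> bool,
    forall i, pr [set x | `[< S i x >] != s i (Q x)] <= t ^+ 2.
  have /choice[s hs] : forall i, exists si : I -> bool,
    pr [set x | `[< S i x >] != si (Q x)] <= t ^+ 2 by move=> i; exact: hA.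
  by exists s.
have mS i : measurable (S i) by exact: mC.
have I0 : (0 < #|I|)%N.
  rewrite lt0n; apply/negP => /eqP/card0_eq I0.
  have : pr setT = 0.
    rewrite (_ : setT = set0) ?pr0//; apply/seteqP; split=> // x _.
    by have := I0 (Q x).
  by rewrite prT => /eqP; rewrite oner_eq0.
have c0 : 0 < t ^+ 2 by exact: exprn_gt0.
have ct : t ^+ 2 <= t / 2 by rewrite expr2; nra.
have c1 : t ^+ 2 < 1 by lra.
have beta4 : - ln (1 - t ^+ 2) - t ^+ 2 * ln (t ^+ 2) <= 4 * t.
  have h1 : - ln (1 - t ^+ 2) <= 2 * t ^+ 2.
    have c1' : 0 < 1 - t ^+ 2 by lra.
    rewrite -lnV ?posrE//; apply: le_trans (ln_le_sub1 _) _; first by rewrite invr_gt0.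
    rewrite lerBlDr -div1r ler_pdivrMr//; nra.
  have h2 : - ln t <= t^-1 - 1.
    by rewrite -lnV ?posrE//; apply: ln_le_sub1; rewrite invr_gt0.
  rewrite lnXn// mulrnAr -mulrnAl.
  have h3 : t ^+ 2 * (- ln t) <= t ^+ 2 * (t^-1 - 1) by rewrite ler_wpM2l// ltW.
  have h4 : t ^+ 2 * (t^-1 - 1) = t - t ^+ 2 by field; rewrite gt_eqF.
  rewrite h4 in h3; lra.
apply: limn_einf_le; near=> n; rewrite lee_fin partition_entropy_joinE.
have n0 : 0 < n%:R :> R by rewrite ltr0n; near: n; exists 1%N.
rewrite /log2; under eq_bigr do rewrite mulrA.
rewrite -mulr_suml -mulNr mulrA ler_pM2r ?invr_gt0// ler_pdivrMl//.
apply: le_trans (join_entropy_bound n I0 mQ mS c0 c1 hs) _.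
have -> : n%:R * (5 * t) = t * n%:R + n%:R * (4 * t) by ring.
apply: lerD; last by rewrite ler_pM2l.
rewrite -ler_pdivrMl// mulrC; near: n.
exact: nbhs_infty_ger.
Unshelve. all: by end_near. Qed.

End entropy.

(** * Averages correlated with an almost invariant set *)

Section bad_average.
Context (R : realType) (d : measure_display) (X : measurableType d).
Variable P : probability X R.
Variable T : invertible_mpt P.
Local Notation pr := (pr P).

Section drift.
Variables (W E : set X).
Hypotheses (mW : measurable W) (mE : measurable E).
Hypothesis WE : forall x, W x -> ~ E x -> W (T x).

Let mTW n : measurable [set x | W (iter n T x)].
Proof. exact: measurable_iter. Qed.

Lemma drift_le n : pr (W `\` [set x | W (iter n T x)]) <= n%:R * pr E.
Proof.
elim: n => [|n IH]; first by rewrite mul0r setDv pr0.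
have mD : measurable (W `\` [set x | W (iter n T x)]) by exact: measurableD.
have mTE : measurable [set x | E (iter n T x)] by exact: measurable_iter.
apply: (@le_trans _ _ (pr ((W `\` [set x | W (iter n T x)]) `|`
    [set x | E (iter n T x)]))).
  apply: pr_le; [exact: measurableD|exact: measurableU|].
  move=> x [Wx nWx]; have [Ex|nEx] := pselect (E (iter n T x)); first by right.
  by left; split=> // Wnx; apply: nWx => /=; exact: WE.
apply: le_trans (prU2 P mD mTE) _.
by rewrite pr_iter// -[in leRHS]natr1 mulrDl mul1r lerD2r.
Qed.

(** $D \cap W$ has the measure of $T^{-n}D \cap T^{-n}W$. Replacing $T^{-n}W$ by $W$ costs $T^{-n}W
    \setminus W$, which has the measure of $W \setminus T^{-n}W$ because $T$ preserves the
    measure. *)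
Lemma correlation_drift n D : measurable D ->
  pr (D `&` W) - n%:R * pr E <= pr ([set x | D (iter n T x)] `&` W).
Proof.
move=> mD.
have mTD : measurable [set x | D (iter n T x)] by exact: measurable_iter.
have mi := measurableI _ _ mTD mW.
have md : measurable ([set x | W (iter n T x)] `\` W) by exact: measurableD.
have h1 : pr ([set x | W (iter n T x)] `\` W) = pr (W `\` [set x | W (iter n T x)]).
  have := prID P (mTW n) mW; have := prID P mW (mTW n).
  by rewrite pr_iter// [W `&` _]setIC => -> /addrI ->.
have h2 : pr (D `&` W) <= pr ([set x | D (iter n T x)] `&` W) +
    pr ([set x | W (iter n T x)] `\` W).
  rewrite -(@pr_iter _ _ _ _ T n); last exact: measurableI.
  apply: le_trans (prU2 P mi md).
  apply: pr_le; [|exact: measurableU|].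
    by apply: measurable_iter; exact: measurableI.
  by move=> x /= [Dx Wx]; have [?|?] := pselect (W x); [left|right].
by have := drift_le n; lra.
Qed.

End drift.

Lemma bad_average (I : finType) (Q : X -> I) (D : set X) (c : R) n :
  ergodic T -> finely_divisible P -> (forall i, measurable [set x | Q x = i]) ->
  measurable D -> 0 < c ->
  (forall s : I -> bool, c < pr [set x | `[< D x >] != s (Q x)]) ->
  exists (sigma : invertible_mpt P) (W : set X),
    [/\ forall x, Q (sigma x) = Q x, measurable W &
      c / 4 < n.+1%:R^-1 *
        (\sum_(i < n.+1) pr ([set x | (sigma @` D) (iter i T x)] `&` W)) -
        pr D * pr W].
Proof.
move=> ergT fineP mQ mD c0 hc.
pose K : R := #|I|%:R.
have K0 : 0 <= K by exact: ler0n.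
have n0 : 0 < n.+1%:R :> R by rewrite ltr0n.
(* Error budget: $Ke$ for filling the cells, $Ke$ for the excess of $W$ over one half, $(n+1)e$ for
   the drift. The gain is $c/2$, so $c/4$ is left. *)
have [e [e0 eE]] : exists e : R, 0 < e /\ (2 * K + n.+1%:R) * e = c / 4.
  exists (c / (4 * (2 * K + n.+1%:R))); split; first by rewrite divr_gt0//; lra.
  by field; rewrite gt_eqF//; lra.
have [W [E [mW mE Ee WE halfW]]] := almost_invariant_half fineP ergT mQ e0.
have [sigma sQ sW] := ergodic_fill ergT mQ mD mW.
exists sigma, W; split=> //.
pose q i := [set x | Q x = i].
have prQ A : measurable A -> pr A = \sum_i pr (A `&` q i).
  move=> mA; rewrite -(pr_label P mQ xpredT mA); congr pr.
  by apply/seteqP; split=> x // [].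
have msD : measurable (sigma @` D) by exact: measurable_mpt_image.
have sepD : c < \sum_i Num.min (pr (D `&` q i)) (pr (q i) - pr (D `&` q i)).
  (* Majority vote: selecting the cells at least half filled by [D] makes the error in each cell the
     smaller of its two parts. *)
  pose s i := pr (q i) - pr (D `&` q i) <= pr (D `&` q i).
  apply: lt_le_trans (hc s) _.
  have mY : measurable [set x | `[< D x >] != s (Q x)].
    exact: (measurable_label_neq mQ).
  rewrite prQ//; apply: ler_sum => i _.
  have mq : measurable (q i) by exact: mQ.
  have mDq := measurableI _ _ mD mq.
  rewrite /s; have [h|h] := leP (pr (q i) - pr (D `&` q i)) (pr (D `&` q i)).
    have -> : pr (q i) - pr (D `&` q i) = pr (q i `\` D).
      by rewrite (prID P mq mD) [q i `&` D]setIC addrC addKr.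
    apply: pr_le; [exact: measurableI|exact: measurableD|].
    move=> x [+ qx]; rewrite /= (qx : Q x = i) /s h.
    by case: asboolP.
  apply: pr_le; [exact: measurableI|by []|].
  move=> x [+ qx]; rewrite /= (qx : Q x = i) /s leNgt h /=.
  by case: asboolP.
have sumq : \sum_i pr (q i) = 1.
  by rewrite -(prT P) [RHS]prQ//; apply: eq_bigr => i _; rewrite setTI.
have prW : pr W <= 1 / 2 + K * e.
  have -> : 1 / 2 + K * e = \sum_i (pr (q i) / 2 + e).
    by rewrite big_split /= -mulr_suml sumq sumr_const mulr_natl.
  rewrite (prQ W)//.
  apply: ler_sum => i _; have := halfW i; rewrite ler_norml -/(q i); lra.
have sume : \sum_(i : I) e = K * e by rewrite sumr_const mulr_natl.
(* In a cell of measure $q$ where [D] has measure $a$, filling gives at least $\min(a, q/2 - e)$,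
   and $\min(a, q/2) = a/2 + \min(a, q - a)/2$. *)
have prDW : pr D / 2 + c / 2 - K * e < pr (sigma @` D `&` W).
  rewrite (prQ (_ `&` W)); last exact: measurableI.
  apply: (@lt_le_trans _ _ (\sum_i (pr (D `&` q i) / 2 +
      Num.min (pr (D `&` q i)) (pr (q i) - pr (D `&` q i)) / 2 - e))).
    rewrite sumrB big_split /= -!mulr_suml -(prQ D)// sume.
    lra.
  apply: ler_sum => i _; apply: le_trans _ (sW i).
  have := halfW i; rewrite -/(q i) ler_norml le_min.
  by rewrite /Num.min; case: ltP => h; lra.
have prD1 := pr_le1 P mD; have prD0 := pr_ge0 P D.
have hsum : pr (sigma @` D `&` W) - n.+1%:R * e <= n.+1%:R^-1 *
    (\sum_(i < n.+1) pr ([set x | (sigma @` D) (iter i T x)] `&` W)).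
  have nE (x : R) : n.+1%:R * x = \sum_(i < n.+1) x.
    by rewrite sumr_const card_ord mulr_natl.
  rewrite ler_pdivlMl// [leLHS]nE.
  apply: ler_sum => i _; apply: le_trans _ (correlation_drift mW mE WE i msD).
  rewrite lerD2l lerN2; apply: ler_pM; [exact: ler0n|exact: pr_ge0| |by []].
  by rewrite ler_nat ltnW.
have : pr D * pr W <= pr D / 2 + K * e.
  apply: (@le_trans _ _ (pr D * (1 / 2 + K * e))); first exact: ler_wpM2l.
  have : pr D * (K * e) <= K * e by apply: ler_piMl => //; exact: mulr_ge0 (ltW e0).
  lra.
move: eE hsum prDW; rewrite mulrDl -mulrA.
move: (_^-1 * _) (pr D * _) (n.+1%:R * e) (K * e) (pr (_ `&` W)) => u v w z t; lra.
Qed.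

End bad_average.

(** * Lebesgue coordinates and the weak topology *)

Section coordinate.
Context (R : realType) (d : measure_display) (X : measurableType d).
Variable P : probability X R.
Local Notation pr := (pr P).

Definition unit_law (g : X -> R) := forall B : set R, measurable B ->
  P (g @^-1` B) = lebesgue_measure (B `&` `[0, 1[%classic).

(** What both conventions on $[0,1)$ have in common, and all that is used later of the Lebesgue
    structure. [h] is defined everywhere, so it can be composed freely; [N] carries the exceptional
    points. *)
Record coordinate (N : set X) (h : X -> R) : Prop := {
  coord_null : measurable N /\ pr N = 0 ;
  coord_meas : measurable_fun setT h ;
  coord_law : unit_law h ;
  coord_range : forall x, 0 <= h x < 1 ;
  coord_inj : forall x y, ~ N x -> ~ N y -> h x = h y -> x = y ;
  coord_borel : forall A, measurable A -> A `<=` ~` N ->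
    exists2 B, measurable B & pr (A `+` h @^-1` B) = 0 ;
  (* Makes h^-1 o g measurable even for the completed sigma-algebra, where
     h @` A need not be a Borel set. *)
  coord_pull : forall g, measurable_fun setT g -> unit_law g ->
    forall A, measurable A -> A `<=` ~` N ->
    measurable (~` N `&` g @^-1` (h @` A)) /\
    P (~` N `&` g @^-1` (h @` A)) = P A }.

(** [iota] is the identity of the line in both applications, read between possibly different
    measurable structures. A measurable set is a Borel set plus a part [N1] of a Borel null set;
    either [N1] is empty or completeness of [nu] takes care of it. *)
Lemma mod0_coordinate d2 (Y : measurableType d2)
    (nu : {measure set Y -> \bar R}) (iota : Y -> R) (iota' : R -> Y) :
  cancel iota iota' -> cancel iota' iota ->
  (forall B : set R, measurable B ->
     measurable (iota @^-1` B) /\ nu (iota @^-1` B) = lebesgue_measure B) ->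
  (forall S : set Y, measurable S -> exists (B F : set R) (N1 : set Y),
     [/\ measurable B, measurable F /\ lebesgue_measure F = 0%E,
         N1 `<=` iota @^-1` F, S = iota @^-1` B `|` N1 &
         N1 = set0 \/ measure_is_complete nu]) ->
  mod0_isomorphic P nu (iota @^-1` `[0, 1[) ->
  exists N h, coordinate N h.
Proof.
move=> iK i'K hB hS [N [M [f [[mN N0] [mM M0] [fsub finj fsurj] fmeas fpres]]]].
pose h x := if `[< N x >] then 0 else iota (f x).
have hN x : ~ N x -> h x = iota (f x) by move=> nN; rewrite /h asboolF.
have mCN : measurable (~` N) by exact: measurableC.
have PN (A : set X) : measurable A -> P (~` N `&` A) = P A.
  move=> mA; rewrite setIC.
  rewrite (prE P mA) (prE P (measurableI _ _ mA mCN)) pr_setI1//.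
  by rewrite prC// /pr N0 subr0.
have m01 : measurable (`[0, 1[%classic : set R) by exact: measurable_itv.
have [mE nuE] := hB _ m01.
have nuM (S : set Y) : measurable S -> nu (S `&` (~` M)) = nu S.
  move=> mS; apply/eqP; rewrite eq_le; apply/andP; split.
    by apply: le_measure; rewrite ?inE//; exact: measurableI _ _ mS (measurableC mM).
  have -> : nu S = nu ((S `&` ~` M) `|` (S `&` M)).
    by rewrite -setIUr setUC setUv setIT.
  apply: le_trans (measureU2 _ _ _) _;
    [exact: measurableI _ _ mS (measurableC mM)|exact: measurableI|].
  rewrite -[leRHS]adde0 leeD2l// -M0; apply: le_measure; rewrite ?inE//.
  exact: measurableI.
have setI_B (A B : set R) : measurable A -> measurable B ->
    lebesgue_measure A = 0%E -> lebesgue_measure (A `&` B) = 0%E.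
  move=> mA mB A0; apply/eqP; rewrite eq_le measure_ge0 andbT -A0.
  by apply: le_measure; rewrite ?inE//; exact: measurableI.
pose A_ (B : set R) := ~` N `&` (iota \o f) @^-1` B.
have imA B : f @` A_ B = iota @^-1` (B `&` `[0, 1[%classic) `&` ~` M.
  apply/seteqP; split=> y.
    by case=> x [nN Bx] <-; have [Ex nM] := fsub x nN.
  case=> -[By Ey] nM; have [x nN xy] := fsurj y (conj Ey nM).
  by subst y; exists x.
have A_sub B : A_ B `<=` ~` N by move=> x [].
have mimA B : measurable B -> measurable (f @` A_ B).
  move=> mB; rewrite imA; apply: measurableI; last exact: measurableC.
  by have [] := hB _ (measurableI _ _ mB m01).
have mA_ B : measurable B -> measurable (A_ B).
  by move=> mB; apply/(fmeas _ (@A_sub B)); exact: mimA.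
have PA_ B : measurable B -> P (A_ B) = lebesgue_measure (B `&` `[0, 1[%classic).
  move=> mB; have [m1 <-] := hB _ (measurableI _ _ mB m01).
  by rewrite -(nuM _ m1) -imA (fpres _ (@A_sub B) (mA_ _ mB)).
have hA_ B : ~` N `&` h @^-1` B = A_ B.
  by apply/seteqP; split=> x [nN]; rewrite /A_ /= hN.
have mh : measurable_fun setT h.
  move=> _ B mB; rewrite setTI -(setUIDK (h @^-1` B) N).
  apply: measurableU.
    (* [h] is constantly 0 on [N], so the preimage of [B] contains [N] or misses it. *)
    have [B0|nB0] := pselect (B 0).
      rewrite (_ : _ `&` _ = N)//; apply/seteqP; split=> x; first by case.
      by move=> Nx; split=> //; rewrite /h /= asboolT.
    rewrite (_ : _ `&` _ = set0)//; apply/seteqP; split=> // x [/= + Nx].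
    by rewrite /h asboolT.
  by rewrite setDE setIC hA_; exact: mA_.
have lawh : unit_law h.
  move=> B mB; rewrite -PA_// -hA_ PN//.
  exact: measurable_preimageT.
have prN : pr N = 0 by rewrite /pr N0.
exists N, h; split=> //.
- move=> x; have [Nx|nN] := pselect (N x).
    by rewrite /h asboolT// lexx ltr01.
  by rewrite hN//; have [+ _] := fsub x nN; rewrite /= in_itv.
- move=> x y nN nN'; rewrite !hN// => /(can_inj iK) fxy.
  by apply: finj; rewrite ?inE.
- move=> A mA AN; have mS : measurable (f @` A) by apply/(fmeas _ AN).
  have [B [F [N1 [mB [mF F0] N1F SE _]]]] := hS _ mS.
  exists B => //; have mY : measurable (A `+` h @^-1` B).
    by apply: measurableY => //; exact: measurable_preimageT.
  have mhF := measurable_preimageT mh mF.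
  apply: (@pr_subset0 _ _ _ P _ (N `|` h @^-1` F)) => //.
  + exact: measurableU.
  + move=> x [[Ax nBx]|[Bx nAx]].
      right; rewrite /= hN; last exact: AN.
      apply: N1F; have : (f @` A) (f x) by exists x.
      rewrite SE => -[] // Bfx; exfalso; apply: nBx.
      by rewrite /= hN//; exact: AN.
    left; apply: contrapT => nN; apply: nAx.
    have : (f @` A) (f x) by rewrite SE; left; rewrite /= -hN.
    case=> y Ay fxy; have -> // : x = y.
    by apply: finj; rewrite ?inE//; exact: AN.
  + apply/eqP; rewrite eq_le pr_ge0 andbT; apply: le_trans (prU2 P mN mhF) _.
    by rewrite prN add0r /pr lawh// setI_B.
- move=> g mg lawg A mA AN; have mS : measurable (f @` A) by apply/(fmeas _ AN).
  have [B [F [N1 [mB [mF F0] N1F SE cN1]]]] := hS _ mS.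
  pose Z := ~` N `&` (iota' \o g) @^-1` N1.
  have -> : ~` N `&` g @^-1` (h @` A) = (~` N `&` g @^-1` B) `|` Z.
    rewrite -setIUr; congr (_ `&` _); apply/seteqP; split=> x /=.
      case=> a Aa ga; have : (f @` A) (f a) by exists a.
      rewrite -ga hN; last exact: AN.
      by rewrite SE iK => -[]; [left|right].
    move=> H; have : (f @` A) (iota' (g x)).
      by rewrite SE; case: H; [left|right] => //=; rewrite i'K.
    by case=> a Aa fa; exists a => //; rewrite hN ?fa ?i'K//; exact: AN.
  have mgB := measurable_preimageT mg mB; have mgF := measurable_preimageT mg mF.
  pose Y0 := ~` N `&` g @^-1` F.
  have mY0 : measurable Y0 by exact: measurableI.
  have PY0 : P Y0 = 0%E by rewrite PN// lawg// setI_B.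
  have ZY0 : Z `<=` Y0 by move=> x [nN /= /N1F /=]; rewrite i'K.
  (* [X] is not assumed complete: the image of [Z] under [f] lies in the null image of [Y0], is
     measurable there by completeness of [nu], and [fmeas] brings this back to [Z]. *)
  have mZ : measurable Z.
    case: cN1 => [N10|cnu].
      by rewrite /Z N10 preimage_set0 setI0.
    have ZN : Z `<=` ~` N by move=> x [].
    have YN : Y0 `<=` ~` N by move=> x [].
    apply/(fmeas _ ZN); apply: cnu; exists (f @` Y0); split.
    + exact/(fmeas _ YN).
    + by rewrite fpres.
    + exact: image_subset.
  have mU : measurable (~` N `&` g @^-1` B) by exact: measurableI.
  split; first exact: measurableU.
  have -> : P ((~` N `&` g @^-1` B) `|` Z) = P (~` N `&` g @^-1` B).
    apply: measureU0 => //; apply/eqP; rewrite eq_le measure_ge0 andbT -PY0.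
    by apply: le_measure; rewrite ?inE.
  rewrite PN// lawg// -(fpres _ AN mA) SE.
  have B01 : B `<=` `[0, 1[%classic.
    move=> b Bb; have : (f @` A) (iota' b) by rewrite SE; left; rewrite /= i'K.
    case=> a Aa fa; have [] := fsub a (AN _ Aa).
    by rewrite fa /= i'K.
  rewrite setIidl//; have [mB' nuB] := hB _ mB; have [mF' nuF] := hB _ mF.
  rewrite -nuB; apply/eqP; rewrite eq_le; apply/andP; split.
    by apply: le_measure; rewrite ?inE -?SE//; rewrite SE; exact: subsetUl.
  have : (nu (iota @^-1` B `|` iota @^-1` F) <= nu (iota @^-1` B))%E.
    have : (nu (iota @^-1` B) + nu (iota @^-1` F) <= nu (iota @^-1` B))%E.
      by rewrite nuF F0 adde0.
    by apply: le_trans; exact: measureU2.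
  apply: le_trans; apply: le_measure; rewrite ?inE -?SE//; first exact: measurableU.
  by rewrite SE; exact: setUS.
Qed.

Lemma lebesgue_space_coordinate : lebesgue_space P -> exists N h, coordinate N h.
Proof.
case=> H.
  apply: (@mod0_coordinate _ _ (@lebesgue_measure R) idfun idfun
    (fun=> erefl) (fun=> erefl) _ _ H) => // S mS.
  by exists S, set0, set0; split=> //; [rewrite setU0|left].
apply: (@mod0_coordinate _ _ (@completed_lebesgue_measure R) idfun idfun
  (fun=> erefl) (fun=> erefl) _ _ H) => [B mB|S].
  by split=> //; exact: sub_caratheodory.
rewrite -completed_caratheodory_measurable g_sigma_completed_algebra_genE.
move=> [B mB [N1 [F [mF F0 N1F]]] <-].
exists B, F, N1; split=> //; right.
exact: completed_lebesgue_measure_is_complete.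
Qed.

End coordinate.

Section coordinate_labels.
Context (R : realType) (d : measure_display) (X : measurableType d).
Variables (P : probability X R) (N : set X) (h : X -> R).
Hypothesis Nh : coordinate P N h.
Local Notation pr := (pr P).

Lemma measurable_coord_preimage (B : set R) :
  measurable B -> measurable (h @^-1` B).
Proof.
by move=> mB; exact: measurable_preimageT (coord_meas Nh) mB.
Qed.

Lemma coordinate_label n : exists p : X -> 'I_n.+1,
  [/\ forall j, measurable [set x | p x = j],
      forall j, pr [set x | p x = j] <= n.+1%:R^-1 &
      forall x y, p x = p y -> `|h x - h y| <= n.+1%:R^-1].
Proof.
have n0 : 0 < n.+1%:R :> R by rewrite ltr0n.
have hn0 x : 0 <= h x * n.+1%:R.
  by have /andP[h0 _] := coord_range Nh x; rewrite mulr_ge0.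
have hlt x : (Num.truncn (h x * n.+1%:R) < n.+1)%N.
  have /andP[_ h1] := coord_range Nh x.
  by rewrite truncn_lt_nat// gtr_pMl.
pose p x := Ordinal (hlt x).
have pE (j : 'I_n.+1) : [set x | p x = j] =
    h @^-1` `[j%:R / n.+1%:R, j.+1%:R / n.+1%:R[%classic.
  apply/seteqP; split=> x /=; rewrite in_itv /= ler_pdivrMr// ltr_pdivlMr//.
    by move=> <-; exact: truncn_itv.
  by move=> hj; apply: val_inj => /=; apply: truncn_def.
exists p; split=> [j|j|x y pxy].
- by rewrite pE; apply: measurable_coord_preimage; exact: measurable_itv.
- have mI : measurable (`[j%:R / n.+1%:R, j.+1%:R / n.+1%:R[%classic : set R).
    exact: measurable_itv.
  rewrite pE -lee_fin -prE; last exact: measurable_coord_preimage.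
  rewrite (coord_law Nh)//; apply: (@le_trans _ _
      (lebesgue_measure (`[j%:R / n.+1%:R, j.+1%:R / n.+1%:R[%classic : set R))).
    apply: le_measure; rewrite ?inE//.
    by apply: measurableI => //; exact: measurable_itv.
  rewrite lebesgue_measure_itv /= lte_fin ltr_pM2r ?invr_gt0// ltr_nat ltnSn.
  by rewrite -EFinB lee_fin -mulrBl -natrB// subSnn mul1r.
- have : [set z | p z = p y] x by [].
  have : [set z | p z = p y] y by [].
  have E (k : nat) : k.+1%:R / n.+1%:R = k%:R / n.+1%:R + n.+1%:R^-1 :> R.
    by rewrite -(natr1 k) mulrDl mul1r.
  rewrite pE /= !in_itv /= E.
  move: (_ / _) => u; move: (_^-1) => v.
  by move=> /andP[? ?] /andP[? ?]; rewrite ler_norml; apply/andP; split; lra.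
Qed.

Lemma coordinate_finely_divisible : finely_divisible P.
Proof.
move=> e e0; pose n := Num.truncn e^-1.
have [p [mp pn _]] := coordinate_label n.
exists n.+1, p; split=> // j; apply: le_trans (pn j) _.
rewrite -[leRHS]invrK lef_pV2 ?posrE ?invr_gt0 ?ltr0n//.
have e0' : 0 <= e^-1 by rewrite invr_ge0 ltW.
by have /andP[_ /ltW] := truncn_itv e0'.
Qed.

End coordinate_labels.

(** * Neighbourhoods given by finite lists of sets *)

Section weak_topology.
Context (R : realType) (d : measure_display) (X : measurableType d).
Variable P : probability X R.
Local Notation pr := (pr P).
Implicit Types phi psi : Phi P.

(** Elements of [Phi] are read through a chosen representative; this makes the choice immaterial for
    distances between images. *)
Lemma ae_eq_image (f g : invertible_mpt P) (A B : set X) :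
  {ae P, forall x, f x = g x} -> measurable A -> measurable B ->
  pr (f @` A `+` B) = pr (g @` A `+` B).
Proof.
move=> [Z [mZ Z0 fgZ]] mA mB.
have mf := measurable_mpt_image f mA; have mg := measurable_mpt_image g mA.
have fg0 : pr (f @` A `+` g @` A) = 0.
  have mfZ := measurable_mpt_image f mZ; have mgZ := measurable_mpt_image g mZ.
  have prZ : pr Z = 0 by rewrite /pr Z0.
  apply: (@pr_subset0 _ _ _ P _ (f @` Z `|` g @` Z)).
  - exact: measurableY.
  - exact: measurableU.
  - have H x : f x <> g x -> Z x by move=> fg; apply: fgZ.
    move=> y [[[x Ax <-] nB]|[[x Ax <-] nB]]; [left|right]; exists x => //; apply: H.
      by move=> fg; apply: nB; exists x.
    by move=> fg; apply: nB; exists x.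
  - by apply/eqP; rewrite eq_le pr_ge0 andbT; apply: le_trans (prU2 P mfZ mgZ) _;
      rewrite !pr_image// prZ addr0.
apply/eqP; rewrite eq_le; apply/andP; split.
  by have := pr_setY_triangle P mf mg mB; rewrite fg0 add0r.
by have := pr_setY_triangle P mg mf mB; rewrite [g @` A `+` f @` A]setYC fg0 add0r.
Qed.

Lemma Phi_repr_pi (f : invertible_mpt P) :
  {ae P, forall x, Phi_repr (\pi_(Phi P) f)%qT x = f x}.
Proof.
apply/asboolP; have : (\pi_(Phi P) (repr (\pi_(Phi P) f)) = \pi_(Phi P) f)%qT.
  exact: reprK.
by move/eqmodP.
Qed.

Lemma weak_nbhs phi (L : seq (set X)) (e : R) :
  (forall A, A \in L -> measurable A) -> 0 < e ->
  nbhs phi [set psi : Phi P |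
    forall A, A \in L -> pr (psi @` A `+` phi @` A) < e].
Proof.
move=> + e0; elim: L => [_|A L IH mL]; first by apply: filterE => psi A; rewrite in_nil.
have mA : measurable A by apply: mL; rewrite mem_head.
have mL' B : B \in L -> measurable B by move=> BL; apply: mL; rewrite in_cons BL orbT.
pose U := [set psi : Phi P | (P (psi @` A `+` phi @` A) < e%:E)%E].
have Uphi : nbhs phi U.
  rewrite nbhsE; exists U => //; split; last first.
    by rewrite /U /= setYK measure0 lte_fin.
  exists [set U]; last by rewrite bigcup_set1.
  move=> _ ->; exists [fset U]%fset; last by rewrite set_fset1 bigcap_set1.
  by move=> V /fset1P ->; rewrite inE; exists phi, A, e.
apply: filterS (filterI Uphi (IH mL')) => psi [Upsi Lpsi] B.
rewrite in_cons => /predU1P[->|/Lpsi//].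
move: Upsi; rewrite /U /= prE ?lte_fin//.
by apply: measurableY; exact: measurable_mpt_image.
Qed.

Lemma weak_basis (U : set (Phi P)) phi : open U -> U phi ->
  exists (L : seq (set X)) (e : R),
    [/\ forall A, A \in L -> measurable A, 0 < e &
      forall psi : Phi P, (forall A, A \in L -> pr (psi @` A `+` phi @` A) < e) -> U psi].
Proof.
move=> oU Uphi; have : nbhs phi U by exact: open_nbhs_nbhs.
rewrite nbhsE => -[_ [[B sB <-] [C BC Cphi] sUV]].
have /sB [D sD IDeC] := BC.
suff [L [e [mL e0 hL]]] : exists (L : seq (set X)) (e : R),
    [/\ forall A, A \in L -> measurable A, 0 < e &
      forall psi : Phi P, (forall A, A \in L -> pr (psi @` A `+` phi @` A) < e) ->
        forall E, E \in enum_fset D -> E psi].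
  exists L, e; split=> // psi /hL psiD; apply: sUV.
  suff Cpsi : C psi by exists C.
  by rewrite -IDeC => E /psiD.
have DE E : E \in enum_fset D -> weak_subbase E /\ E phi.
  move=> ED; split; first by have := sD _ ED; rewrite inE.
  by move: Cphi; rewrite -IDeC; apply.
elim: (enum_fset D) DE => [_|E s IH DE].
  by exists [::], 1; split.
have [|L [e [mL e0 hL]]] := IH.
  by move=> F Fs; apply: DE; rewrite in_cons Fs orbT.
have [[phi' [A [e' [mA e'0 EE]]]] Ephi] := DE E (mem_head _ _).
(* Recentring: the room left around [phi] in a subbasic set centred at [phi'], used through the
   triangle inequality. *)
pose r := e' - pr (phi @` A `+` phi' @` A).
have mI f : measurable ((f : Phi P) @` A) by exact: measurable_mpt_image.
have r0 : 0 < r.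
  move: Ephi; rewrite EE /= prE ?lte_fin ?subr_gt0//; exact: measurableY.
exists (A :: L), (Num.min e r); split.
- by move=> F; rewrite in_cons => /predU1P[->|/mL].
- by rewrite lt_min e0.
- move=> psi hpsi F; rewrite in_cons => /predU1P[->|]; last first.
    apply: hL => G GL; have := hpsi G; rewrite in_cons GL orbT lt_min.
    by move=> /(_ isT)/andP[].
  have := hpsi A (mem_head _ _); rewrite lt_min => /andP[_].
  rewrite EE /= prE; last exact: measurableY.
  rewrite lte_fin /r; have := pr_setY_triangle P (mI psi) (mI phi) (mI phi'); lra.
Qed.

Lemma weak_openP (U : set (Phi P)) :
  (forall phi, U phi -> exists (L : seq (set X)) (e : R),
    [/\ forall A, A \in L -> measurable A, 0 < e &
      forall psi : Phi P, (forall A, A \in L -> pr (psi @` A `+` phi @` A) < e) -> U psi])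
  -> open U.
Proof.
move=> hU; rewrite openE => phi /hU [L [e [mL e0 hL]]].
by apply: filterS (weak_nbhs phi mL e0) => psi /hL.
Qed.

End weak_topology.

(** * The weak topology is Baire *)

Section limsup_sets.
Context (R : realType) (d : measure_display) (X : measurableType d).
Variable P : probability X R.
Local Notation pr := (pr P).
Implicit Types F : (set X)^nat.

Lemma measurable_tail F n : (forall k, measurable (F k)) ->
  measurable (\bigcup_(k in [set k | (n <= k)%N]) F k).
Proof. by move=> mF; apply: bigcup_measurable => k _. Qed.

Lemma measurable_lim_sup_set F : (forall k, measurable (F k)) ->
  measurable (lim_sup_set F).
Proof. by move=> mF; apply: bigcapT_measurable => n; exact: measurable_tail. Qed.

(** Borel-Cantelli. Finite unions from index $n$ on satisfy a telescoping bound, so the tail union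
    has measure at most $2 \cdot 2^{-n}$. *)
Lemma pr_lim_sup_set_geometric F : (forall k, measurable (F k)) ->
  (forall k, pr (F k) <= 2^-1 ^+ k) -> pr (lim_sup_set F) = 0.
Proof.
move=> mF hF; apply/eqP; rewrite eq_le pr_ge0 andbT.
have half0 k : 0 < 2^-1 ^+ k :> R by rewrite exprn_gt0.
have tail n : pr (\bigcup_(k in [set k | (n <= k)%N]) F k) <= 2 * 2^-1 ^+ n.
  pose G m := \bigcup_(k in [set k | (n <= k < n + m)%N]) F k.
  have mG m : measurable (G m) by apply: bigcup_measurable.
  have hG m : pr (G m) <= 2 * 2^-1 ^+ n - 2 * 2^-1 ^+ (n + m).
    elim: m => [|m IH].
      rewrite addn0 subrr (_ : G _ = set0) ?pr0//.
      apply/seteqP; split=> // x [k /=].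
      by rewrite addn0 => /andP[nk kn]; have := leq_ltn_trans nk kn; rewrite ltnn.
    apply: (@le_trans _ _ (pr (G m `|` F (n + m)%N))).
      apply: pr_le => //; first exact: measurableU.
      move=> x [k /= /andP[nk]]; rewrite addnS ltnS leq_eqVlt => /predU1P[->|km] Fx.
        by right.
      by left; exists k => //=; rewrite nk.
    apply: le_trans (prU2 P (mG m) (mF _)) _.
    by have := hF (n + m)%N; rewrite addnS exprS; lra.
  have cG : pr (G m) @[m --> \oo] --> pr (\bigcup_m G m).
    apply: pr_nondecreasing_cvg => //; apply/nondecreasing_seqP => m.
    apply/subsetPset => x [k /= /andP[nk km] Fx]; exists k => //=.
    by rewrite nk addnS ltnS ltnW.
  rewrite (_ : \bigcup_(k in _) F k = \bigcup_m G m); last first.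
    apply/seteqP; split=> x [k].
      move=> /= nk Fx; exists (k - n).+1 => //; exists k => //=.
      by apply/andP; split=> //; lia.
    by move=> _ [j /= /andP[nj _] Fx]; exists j.
  rewrite -(cvg_lim _ cG)//; apply: limr_le; first by apply/cvg_ex; eexists; exact: cG.
  by apply: nearW => m; have := hG m; have := half0 (n + m)%N; lra.
have c0 : 2 * 2^-1 ^+ n @[n --> \oo] --> (0 : R).
  rewrite -[X in _ --> X](mulr0 2); apply: cvgM; first exact: cvg_cst.
  by apply: cvg_expr; rewrite ger0_norm// invf_lt1// ltr1n.
rewrite -(cvg_lim _ c0)//; apply: limr_ge; first by apply/cvg_ex; eexists; exact: c0.
apply: nearW => n; apply: le_trans _ (tail n); apply: pr_le.
- exact: measurable_lim_sup_set.
- exact: measurable_tail.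
- exact: bigcap_inf.
Qed.

Lemma pr_lim_sup_set_cvg0 F : (forall k, measurable (F k)) ->
  pr (lim_sup_set F) = 0 -> pr (F k) @[k --> \oo] --> (0 : R).
Proof.
move=> mF F0.
have mT n := measurable_tail n mF.
have cT : pr (\bigcup_(j in [set j | (k <= j)%N]) F j) @[k --> \oo] --> (0 : R).
  rewrite -F0; apply: pr_nonincreasing_cvg => //.
  apply/nonincreasing_seqP => n; apply/subsetPset => x [k /= nk Fx].
  by exists k => //=; rewrite ltnW.
apply: (squeeze_cvgr _ (cvg_cst 0) cT); apply: nearW => k.
rewrite pr_ge0 /=; apply: pr_le => // x Fx.
by exists k => /=.
Qed.

End limsup_sets.

Section cauchy_limit.
Context (R : realType).

(** Adding the geometric tail $2 \cdot 2^{-k}$ makes the sequence eventually nonincreasing while it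
    stays bounded below. *)
Lemma cvg_of_geometric_increments (u : R^nat) (a : R) :
  (forall k, a <= u k) ->
  (\forall k \near \oo, `|u k.+1 - u k| <= 2^-1 ^+ k) -> cvgn u.
Proof.
move=> au [K _ hK].
pose w k := u (k + K)%N + 2 * 2^-1 ^+ (k + K).
have cw : cvgn w.
  apply: nonincreasing_is_cvgn.
    apply/nonincreasing_seqP => k; rewrite /w addSn exprS.
    by have := hK (k + K)%N (leq_addl _ _); rewrite ler_norml; lra.
  exists a => _ [k _ <-]; apply: le_trans (au (k + K)%N) _.
  by rewrite lerDl mulr_ge0// exprn_ge0.
have cg : (fun k => 2 * 2^-1 ^+ (k + K)) @ \oo --> (2 * 0 : R).
  apply: cvgM; first exact: cvg_cst.
  rewrite (cvg_shiftn K (fun k => 2^-1 ^+ k : R)).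
  by apply: cvg_expr; rewrite ger0_norm// invf_lt1// ltr1n.
apply/cvg_ex; exists (limn w - 2 * 0).
rewrite -(cvg_shiftn K).
rewrite (_ : [sequence _]_n = fun n => w n - 2 * 2^-1 ^+ (n + K)); last first.
  by apply/funext => n; rewrite /w /= addrK.
by apply: cvgB.
Qed.

End cauchy_limit.

(** * Point maps as limits of rapidly Cauchy sequences *)

Section limit_map.
Context (R : realType) (d : measure_display) (X : measurableType d).
Variables (P : probability X R) (N : set X) (h : X -> R).
Hypothesis Nh : coordinate P N h.
Local Notation pr := (pr P).

Let m01 : measurable (`[0, 1[%classic : set R).
Proof. exact: measurable_itv. Qed.

Let leb_le1 (B : set R) : measurable B ->
  (lebesgue_measure (B `&` `[0%R, 1%R[%classic) <= 1%:E)%E.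
Proof.
move=> mB; apply: (@le_trans _ _ (lebesgue_measure (`[0%R, 1%R[%classic : set R))).
  by apply: le_measure; rewrite ?inE//; exact: measurableI.
by rewrite lebesgue_measure_itv /= lte_fin ltr01 oppr0 adde0.
Qed.

(** One inequality on open sets is enough: outer regularity extends it to Borel sets, and applying
    it to a set and to its complement forces equality of two probabilities. *)
Lemma unit_lawP (g : X -> R) : measurable_fun setT g ->
  (forall U : set R, open U -> pr (g @^-1` U) <= pr (h @^-1` U)) ->
  unit_law P g.
Proof.
move=> mg gU.
have mgB (B : set R) : measurable B -> measurable (g @^-1` B).
  by move=> mB; exact: measurable_preimageT.
have mhB := measurable_coord_preimage Nh.
have le_gh (B : set R) : measurable B -> pr (g @^-1` B) <= pr (h @^-1` B).
  move=> mB; apply/ler_addgt0Pr => e e0; have e2 : 0 < e / 2 by lra.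
  have mB01 : measurable (B `&` `[0, 1[%classic) by exact: measurableI.
  have [|U [oU BU UB]] := lebesgue_regularity_outer mB01 _ e2.
    by apply: le_lt_trans (leb_le1 mB) _; rewrite ltry.
  have mU := open_measurable oU.
  (* A limit of values in $[0,1)$ can be 1, and regularity only covers $B \cap [0,1)$. The point 1
     is covered by [I1], at cost at most [e / 2]; the complement of $[0,1]$ is free since [h] avoids
     it. *)
  pose I1 : set R := `]1 - e / 2, 1 + e / 2[%classic.
  have mI1 : measurable I1 by exact: measurable_itv.
  pose W := U `|` ~` `[0, 1]%classic `|` I1.
  have oW : open W.
    apply: openU; last exact: interval_open.
    by apply: openU => //; apply: closed_openC; exact: itv_closed.
  have mW := open_measurable oW.
  have mUB : measurable (U `\` (B `&` `[0, 1[%classic)) by exact: measurableD.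
  apply: (@le_trans _ _ (pr (h @^-1` W))).
    apply: le_trans (gU W oW); apply: pr_le; [exact: mgB|exact: mgB|].
    move=> x Bx; have [g01|ng01] := pselect (`[0, 1]%classic (g x)); last first.
      by left; right.
    have [g1|g1] := eqVneq (g x) 1.
      by right; rewrite /I1 /= in_itv /= g1; apply/andP; split; lra.
    left; left; apply: BU; split=> //=.
    by move: g01; rewrite /= !in_itv /= => /andP[-> g1']; rewrite lt_neqAle g1.
  apply: (@le_trans _ _ (pr (h @^-1` B `|`
      (h @^-1` (U `\` (B `&` `[0, 1[%classic)) `|` h @^-1` I1)))).
    apply: pr_le; [exact: mhB|by do 2?apply: measurableU; exact: mhB|].
    move=> x [[Ux|nx]|Ix]; last by right; right.
      have [Bx|nBx] := pselect (B (h x)); first by left.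
      by right; left; split=> // -[].
    exfalso; apply: nx; have /andP[h0 h1] := coord_range Nh x.
    by rewrite /= in_itv /= h0 ltW.
  apply: le_trans (prU2 P (mhB _ mB) (measurableU _ _ (mhB _ mUB) (mhB _ mI1))) _.
  rewrite lerD2l; apply: le_trans (prU2 P (mhB _ mUB) (mhB _ mI1)) _.
  rewrite [leRHS](_ : _ = e / 2 + e / 2); last by lra.
  apply: lerD.
    rewrite -lee_fin -prE; last exact: mhB.
    rewrite (coord_law Nh)//; apply: le_trans _ (ltW UB).
    by apply: le_measure; rewrite ?inE//; exact: measurableI.
  rewrite -lee_fin -prE; last exact: mhB.
  rewrite (coord_law Nh)//.
  apply: (@le_trans _ _ (lebesgue_measure (`[1 - e / 2, 1[%classic : set R))).
    apply: le_measure; rewrite ?inE; [exact: measurableI|exact: measurable_itv|].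
    move=> r [] /=; rewrite !in_itv /= => /andP[/ltW -> _] /andP[_ ->].
    by [].
  rewrite lebesgue_measure_itv /= lte_fin ltrBlDr ltrDl e2 -EFinB lee_fin.
  by rewrite opprB addrCA subrr addr0.
move=> B mB; rewrite -(coord_law Nh mB) !prE; [|exact: mhB|exact: mgB].
congr EFin; apply/eqP; rewrite eq_le le_gh//=.
have := le_gh _ (measurableC mB).
rewrite -[g @^-1` _]/(~` (g @^-1` B)) -[h @^-1` _]/(~` (h @^-1` B)).
rewrite (prC P (mgB _ mB)) (prC P (mhB _ mB)); lra.
Qed.

Section limit_of.
Variable f : nat -> invertible_mpt P.
Hypothesis f_cauchy : forall k,
  pr [set x | 2^-1 ^+ k < `|h (f k.+1 x) - h (f k x)|] <= 2^-1 ^+ k.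

Let mhf k : measurable_fun setT (h \o f k).
Proof.
by apply: measurableT_comp; [exact: (coord_meas Nh)|exact: measurable_mpt_fun].
Qed.

Let B k := [set x | 2^-1 ^+ k < `|h (f k.+1 x) - h (f k x)|].

Let mB k : measurable (B k).
Proof.
rewrite -[X in measurable X]setTI; apply: measurable_fun_ltr => //.
apply: measurableT_comp => //; exact: measurable_funB (mhf k.+1) (mhf k).
Qed.

Let L := lim_sup_set B.

Let g x := limn_sup (fun k => h (f k x)).

Let hg x : ~ L x -> h (f k x) @[k --> \oo] --> g x.
Proof.
move=> nL; have cv : cvgn (fun k => h (f k x)).
  apply: (@cvg_of_geometric_increments _ _ 0).
    by move=> k; have /andP[] := coord_range Nh (f k x).
  move/existsNP : nL => [n /not_implyP[_ nT]]; exists n => // k /= nk.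
  by rewrite leNgt; apply/negP => Bx; apply: nT; exists k.
by rewrite /g cvg_limn_supE.
Qed.

Let mg : measurable_fun setT g.
Proof.
apply: measurable_fun_limn_sup => [x _|x _|k]; last exact: mhf.
- by exists 1 => _ [k _ <-]; have /andP[_ /ltW] := coord_range Nh (f k x).
- by exists 0 => _ [k _ <-]; have /andP[] := coord_range Nh (f k x).
Qed.

Let L0 : pr L = 0.
Proof. exact: pr_lim_sup_set_geometric. Qed.

Let mL : measurable L. Proof. exact: measurable_lim_sup_set. Qed.

Let lawhf k : unit_law P (h \o f k).
Proof.
move=> A mA; rewrite comp_preimage mpt_preserving; first exact: (coord_law Nh).
exact: (measurable_coord_preimage Nh).
Qed.

(** Off [L] the values converge, so a point whose limit lies in the open set [U] ends up in [U] for
    good: escaping infinitely often is a null event. *)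
Let open_escape (U : set R) : open U ->
  pr (g @^-1` U `\` (h \o f k) @^-1` U) @[k --> \oo] --> (0 : R).
Proof.
move=> oU; have mU := open_measurable oU.
apply: pr_lim_sup_set_cvg0.
  by move=> k; apply: measurableD; exact: measurable_preimageT.
have mF k : measurable (g @^-1` U `\` (h \o f k) @^-1` U).
  by apply: measurableD; exact: measurable_preimageT.
apply: (pr_subset0 (measurable_lim_sup_set mF) mL _ L0) => x Fx.
apply: contrapT => /hg hx.
have [_ _ [Ux _]] := Fx 0%N I.
have [n _ hn] : \forall k \near \oo, U (h (f k x)).
  by apply: hx; exact: open_nbhs_nbhs.
by have [k /= nk [_ nU]] := Fx n I; apply: nU; exact: hn.
Qed.

Let lawg : unit_law P g.
Proof.
apply: unit_lawP => // U oU; have mU := open_measurable oU.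
have : pr (g @^-1` U) - pr (h @^-1` U) <= 0.
  rewrite -(cvg_lim _ (open_escape oU))//; apply: limr_ge.
    by apply/cvg_ex; eexists; exact: open_escape.
  apply: nearW => k; rewrite lerBlDr.
  have mk := measurable_preimageT (mhf k) mU; have mgU := measurable_preimageT mg mU.
  have -> : pr (h @^-1` U) = pr ((h \o f k) @^-1` U).
    by rewrite /pr (lawhf k mU) (coord_law Nh).
  rewrite (prID P mgU mk) addrC lerD2l; apply: pr_le => //.
  exact: measurableI.
by rewrite subr_le0.
Qed.

Let lift_pt x : exists y, ~ N x -> (h @` (~` N)) (g x) -> ~ N y /\ h y = g x.
Proof.
have [[y nN hy]|H] := pselect ((h @` (~` N)) (g x)); first by exists y.
by exists x.
Qed.

(** [gamma] is $h^{-1} \circ g$ on [D], of full measure because [g] has the law of [h], and the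
    identity elsewhere; [coord_pull] supplies measurability and preservation. For the convergence,
    [A] becomes $h^{-1}S$ with [S] Borel, and [S] a slightly larger open set, to which [open_escape]
    applies. *)
Lemma limit_map : exists gamma : X -> X,
  [/\ measurable_fun setT gamma,
      forall A, measurable A -> P (gamma @^-1` A) = P A &
      forall A, measurable A ->
        pr (f k @^-1` A `+` gamma @^-1` A) @[k --> \oo] --> (0 : R)].
Proof.
have [nu hnu] := choice lift_pt.
pose D := ~` N `&` g @^-1` (h @` (~` N)).
have [mN N0] := coord_null Nh.
have mCN : measurable (~` N) by exact: measurableC.
have [mD PD] := coord_pull Nh mg lawg mCN (@subset_refl _ _).
pose gamma x := if `[< D x >] then nu x else x.
have gD x : D x -> ~ N (gamma x) /\ h (gamma x) = g x.
  by move=> Dx; rewrite /gamma asboolT//; case: (Dx) => ? ?; exact: hnu.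
have prD : pr D = 1 by rewrite /pr PD -/(pr _) prC// N0 subr0.
have gammaA A : measurable A -> D `&` gamma @^-1` A =
    ~` N `&` g @^-1` (h @` (A `\` N)).
  move=> mA; apply/seteqP; split=> x.
    case=> Dx Ax; have [nNg hgx] := gD x Dx; split; first by case: Dx.
    by exists (gamma x).
  case=> nN [a [Aa nNa] ga]; have Dx : D x by split=> //; exists a.
  split=> //=; have [nNg hgx] := gD x Dx.
  by rewrite (_ : gamma x = a)//; apply: (coord_inj Nh) => //; rewrite hgx.
have pull A : measurable A -> measurable (D `&` gamma @^-1` A) /\
    P (D `&` gamma @^-1` A) = P (A `\` N).
  move=> mA; rewrite gammaA//; apply: (coord_pull Nh) => //.
  exact: measurableD.
have mgamma : measurable_fun setT gamma.
  move=> _ A mA; rewrite setTI.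
  rewrite (_ : gamma @^-1` A = (D `&` gamma @^-1` A) `|` (A `\` D)).
    by apply: measurableU; [have [] := pull A mA|exact: measurableD].
  apply/seteqP; split=> x.
    have [Dx|nD] := pselect (D x); first by left.
    by rewrite /preimage /= {1}/gamma asboolF// => Ax; right.
  by case=> [[]//|[Ax nD]]; rewrite /preimage /= /gamma asboolF.
have mgA A : measurable A -> measurable (gamma @^-1` A).
  by move=> mA; exact: measurable_preimageT.
have Pgamma A : measurable A -> pr (gamma @^-1` A) = pr A.
  move=> mA; rewrite -(pr_setI1 (mgA _ mA) mD prD) setIC /pr (pull A mA).2 -/(pr _).
  rewrite setDE pr_setI1//; by rewrite prC// N0 subr0.
exists gamma; split=> // [A mA|A mA].
  by rewrite (prE P mA) (prE P (mgA _ mA)) Pgamma.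
have mAN : measurable (A `\` N) by exact: measurableD.
have [S mS AS0] := coord_borel Nh mAN (@subDsetr _ _ _).
apply/cvgrPdist_le => e e0.
have e2 : 0 < e / 4 by lra.
have mS01 : measurable (S `&` `[0, 1[%classic) by exact: measurableI.
have [|U [oU SU US]] := lebesgue_regularity_outer mS01 _ e2.
  by apply: le_lt_trans (leb_le1 mS) _; rewrite ltry.
have mU := open_measurable oU.
have /cvgrPdist_le/(_ _ e2) := open_escape oU.
apply: filterS => k; rewrite !sub0r !normrN !ger0_norm ?pr_ge0// => hk.
have mhS := measurable_coord_preimage Nh mS.
have mAS : measurable (A `+` h @^-1` S) by exact: measurableY.
have AS : pr (A `+` h @^-1` S) = 0.
  apply: (@pr_subset0 _ _ _ P _ (((A `\` N) `+` h @^-1` S) `|` N)) => //.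
  - by apply: measurableU => //; exact: measurableY.
  - move=> x; have [Nx|nN] := pselect (N x); first by right.
    by case=> [[Ax nS]|[Sx nA]]; left; [left|right; split=> // -[]].
  - apply/eqP; rewrite eq_le pr_ge0 andbT.
    apply: le_trans (prU2 P (measurableY mAN mhS) mN) _.
    by rewrite AS0 N0 addr0.
pose bk := (h \o f k) @^-1` S; pose b := g @^-1` S.
have mbk : measurable bk by exact: measurable_preimageT.
have mb : measurable b by exact: measurable_preimageT.
have mfA : measurable (f k @^-1` A) by exact: measurable_mpt_preimage.
have h1 : pr (f k @^-1` A `+` bk) = 0.
  rewrite -AS -(pr_preimage (f k) mAS); congr pr.
have h2 : pr (b `+` gamma @^-1` A) = 0.
  apply: (@pr_subset0 _ _ _ P _ (~` D `|` gamma @^-1` (A `+` h @^-1` S))).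
  - by apply: measurableY => //; exact: mgA.
  - by apply: measurableU; [exact: measurableC|exact: mgA].
  - move=> x; have [Dx|nD] := pselect (D x); last by left.
    have [_ hgx] := gD x Dx; rewrite /b /preimage /= -hgx.
    by case=> -[H1 H2]; right; [right|left].
  - apply/eqP; rewrite eq_le pr_ge0 andbT.
    apply: le_trans (prU2 P (measurableC mD) (mgA _ mAS)) _.
    by rewrite prC// prD subrr add0r Pgamma// AS.
have prb : pr b = pr bk by rewrite /pr lawg// (lawhf k mS).
have h3 : pr (b `\` bk) <= e / 2.
  have mhk := mhf k.
  have muk := measurable_preimageT mhk mU; have mu := measurable_preimageT mg mU.
  pose V := U `\` S; have mV : measurable V by exact: measurableD.
  pose V' := S `\` U; have mV' : measurable V' by exact: measurableD.
  have mVk := measurable_preimageT mhk mV; have mVg := measurable_preimageT mg mV'.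
  have md : measurable (g @^-1` U `\` (h \o f k) @^-1` U) by exact: measurableD.
  apply: (@le_trans _ _ (pr ((g @^-1` U `\` (h \o f k) @^-1` U) `|`
      ((h \o f k) @^-1` V `|` g @^-1` V')))).
    apply: pr_le; [exact: measurableD|by do 2?apply: measurableU|].
    move=> x [bx nbx]; have [Ugx|nU] := pselect (U (g x)); last by right; right.
    have [Ukx|nU] := pselect (U (h (f k x))); last by left.
    by right; left.
  apply: le_trans (prU2 P md (measurableU _ _ mVk mVg)) _.
  have -> : e / 2 = e / 4 + e / 4 by lra.
  apply: lerD => //; apply: le_trans (prU2 P mVk mVg) _.
  (* [V'] misses $[0,1)$, which carries the law of [g]. *)
  have -> : pr (g @^-1` V') = 0.
    rewrite /pr lawg// (_ : _ `&` _ = set0) ?measure0//.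
    apply/seteqP; split=> // r [[Sr nUr] r01]; apply: nUr; exact: SU.
  rewrite addr0 -lee_fin -prE// (lawhf k mV); apply: le_trans _ (ltW US).
  apply: le_measure; rewrite ?inE; [exact: measurableI|exact: measurableD|].
  by move=> r [[Ur nS] r01]; split=> // -[].
(* [b] and [bk] have equal measure, so their two one-sided differences do too, and the bound [e / 2]
   on one gives [e]. *)
have h4 : pr (bk `+` b) <= e.
  have mD1 : measurable (bk `\` b) by exact: measurableD.
  have mD2 : measurable (b `\` bk) by exact: measurableD.
  apply: le_trans (prU2 P mD1 mD2) _.
  have : pr (bk `\` b) = pr (b `\` bk).
    have := prID P mbk mb; have := prID P mb mbk.
    by rewrite -prb [b `&` bk]setIC => -> /addrI.
  by move=> ->; lra.
have mgAA := mgA _ mA.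
have := pr_setY_triangle P mfA mbk mgAA.
have := pr_setY_triangle P mbk mb mgAA.
lra.
Qed.

End limit_of.

End limit_map.

(** * From almost everywhere inverses to a bijection *)

Section ae_invertible.
Context (R : realType) (d : measure_display) (X : measurableType d).
Variables (P : probability X R) (theta gamma : X -> X).
Local Notation pr := (pr P).
Hypotheses (mtheta : measurable_fun setT theta)
  (mgamma : measurable_fun setT gamma).
Hypothesis Ptheta : forall A, measurable A -> P (theta @^-1` A) = P A.
Hypothesis Pgamma : forall A, measurable A -> P (gamma @^-1` A) = P A.
Variable Z0 : set X.
Hypotheses (mZ0 : measurable Z0) (Z01 : pr Z0 = 1).
Hypothesis gammaK : forall x, Z0 x -> gamma (theta x) = x.
Hypothesis thetaK : forall x, Z0 x -> theta (gamma x) = x.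

Let iter_good (u : X -> X) n : measurable_fun setT u ->
  (forall A, measurable A -> P (u @^-1` A) = P A) ->
  measurable [set x | Z0 (iter n u x)] /\ pr [set x | Z0 (iter n u x)] = 1.
Proof.
move=> mu Pu; elim: n => [//|n [IHm IH]].
rewrite (_ : [set x | _] = u @^-1` [set x | Z0 (iter n u x)]); last first.
  by apply/seteqP; split=> x; rewrite /preimage /= -iterSr.
by split; [exact: measurable_preimageT|rewrite /pr Pu].
Qed.

(* On the points whose whole orbit avoids the exceptional null set, theta and
   gamma are mutually inverse bijections. *)
Let Z := \bigcap_n ([set x | Z0 (iter n theta x)] `&` [set x | Z0 (iter n gamma x)]).

Let mZn n : measurable ([set x | Z0 (iter n theta x)] `&` [set x | Z0 (iter n gamma x)]).
Proof.
by apply: measurableI; [have [] := iter_good n mtheta Ptheta|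
  have [] := iter_good n mgamma Pgamma].
Qed.

Let mZ : measurable Z. Proof. exact: bigcapT_measurable. Qed.

Let ZC0 : pr (~` Z) = 0.
Proof.
rewrite /Z setC_bigcap; apply: pr_bigcup0 => n; first exact: measurableC.
rewrite prC//; have [m1 p1] := iter_good n mtheta Ptheta.
have [m2 p2] := iter_good n mgamma Pgamma.
by rewrite pr_setI1// p1 subrr.
Qed.

Let Ztheta x : Z x -> Z (theta x).
Proof.
move=> Zx n _; split; first by have [+ _] := Zx n.+1 I; rewrite /= -iterS iterSr.
case: n => [|n]; first by have [] := Zx 1%N I.
by rewrite /= -iterS iterSr gammaK; [have [] := Zx n I|have [] := Zx 0%N I].
Qed.

Let Zgamma x : Z x -> Z (gamma x).
Proof.
move=> Zx n _; split; last by have [_] := Zx n.+1 I; rewrite /= -iterS iterSr.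
case: n => [|n]; first by have [] := Zx 1%N I.
by rewrite /= -iterS iterSr thetaK; [have [] := Zx n I|have [] := Zx 0%N I].
Qed.

Let on_Z (u : X -> X) x := if `[< Z x >] then u x else x.

Let on_ZK (u v : X -> X) : (forall x, Z x -> Z (u x)) ->
  (forall x, Z x -> v (u x) = x) -> cancel (on_Z u) (on_Z v).
Proof.
move=> Zu uK x; rewrite /on_Z; have [Zx|nZx] := pselect (Z x).
  by rewrite (asboolT Zx) (asboolT (Zu _ Zx)) uK.
by rewrite !(asboolF nZx).
Qed.

Let on_Z_pre u A : on_Z u @^-1` A = (Z `&` u @^-1` A) `|` (A `\` Z).
Proof.
apply/seteqP; split=> x; rewrite /preimage /= /on_Z.
  by have [Zx|nZx] := pselect (Z x); [rewrite (asboolT Zx); left|rewrite (asboolF nZx); right].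
case=> -[H1 H2]; first by rewrite asboolT.
by rewrite asboolF.
Qed.

Let measurable_on_Z u : measurable_fun setT u -> measurable_fun setT (on_Z u).
Proof.
move=> mu _ A mA; rewrite setTI on_Z_pre; apply: measurableU.
  by apply: measurableI => //; exact: measurable_preimageT.
exact: measurableD.
Qed.

Let on_Z_ae u A : measurable_fun setT u -> measurable A ->
  pr (on_Z u @^-1` A `+` u @^-1` A) = 0.
Proof.
move=> mu mA; apply: (pr_subset0 _ (measurableC mZ) _ ZC0).
  by apply: measurableY; apply: measurable_preimageT => //; exact: measurable_on_Z.
move=> x + Zx; rewrite /preimage /= /on_Z /setY /setD /= asboolT//.
by case=> -[].
Qed.

(** [invertible_mpt] demands a bijection everywhere, so both maps are kept on [Z] and replaced by
    the identity off it. Images under [psi] are preimages under its inverse, whence [gamma] in the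
    conclusion. *)
Lemma ae_inverse_mpt : exists psi : invertible_mpt P,
  forall A, measurable A -> pr (psi @` A `+` gamma @^-1` A) = 0.
Proof.
have ZZ0 x : Z x -> Z0 x by move=> Zx; have [] := Zx 0%N I.
have tK := on_ZK Ztheta (fun x Zx => gammaK (ZZ0 x Zx)).
have gK := on_ZK Zgamma (fun x Zx => thetaK (ZZ0 x Zx)).
have mt := measurable_on_Z mtheta; have mg := measurable_on_Z mgamma.
have Pt A : measurable A -> P (on_Z theta @^-1` A) = P A.
  move=> mA; rewrite -(Ptheta mA); have m1 := measurable_preimageT mt mA; have m2 := measurable_preimageT mtheta mA.
  rewrite (prE P m1) (prE P m2); congr EFin; apply/eqP.
  rewrite -subr_eq0 -normr_eq0 eq_le normr_ge0 andbT -(on_Z_ae mtheta mA).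
  exact: pr_dist.
exists (InvertibleMpt tK gK mt mg Pt) => A mA.
by rewrite mpt_imageE /=; exact: on_Z_ae.
Qed.

End ae_invertible.

Section baire.
Context (R : realType) (d : measure_display) (X : measurableType d).
Variables (P : probability X R) (N : set X) (h : X -> R).
Hypothesis Nh : coordinate P N h.
Local Notation pr := (pr P).

(** Each rational ray of [h] is preserved up to a null set, so [h (f x) = h x] off a countable union
    of null sets; then [h] is injective off [N]. *)
Lemma measure_class_ae_id (f : X -> X) : measurable_fun setT f ->
  (forall A, measurable A -> P (f @^-1` A) = P A) ->
  (forall A, measurable A -> pr (f @^-1` A `+` A) = 0) ->
  exists Z, [/\ measurable Z, pr Z = 1 & forall x, Z x -> f x = x].
Proof.
move=> mf Pf f0.
have [mN N0] := coord_null Nh.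
pose A n : set X := if choice.unpickle n is Some q then
  h @^-1` `]-oo, (ratr (q : rat))[%classic else set0.
have mA n : measurable (A n).
  rewrite /A; case: choice.unpickle => [q|//].
  by apply: (measurable_coord_preimage Nh); exact: measurable_itv.
pose B := \bigcup_n (f @^-1` (A n) `+` A n).
have mB : measurable B.
  by apply: bigcupT_measurable => n; apply: measurableY => //; exact: measurable_preimageT.
have B0 : pr B = 0.
  by apply: pr_bigcup0 => n; [apply: measurableY => //; exact: measurable_preimageT|exact: f0].
have mfN := measurable_preimageT mf mN.
have mM : measurable (B `|` (N `|` f @^-1` N)).
  by apply: measurableU => //; exact: measurableU.
exists (~` (B `|` (N `|` f @^-1` N))); split.
- exact: measurableC.
- rewrite prC// (_ : pr _ = 0) ?subr0//; apply/eqP; rewrite eq_le pr_ge0 andbT.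
  apply: le_trans (prU2 P mB (measurableU _ _ mN mfN)) _.
  rewrite B0 add0r; apply: le_trans (prU2 P mN mfN) _.
  by rewrite N0 add0r /pr Pf// -/(pr N) N0.
- move=> x nM; have nB : ~ B x by move=> ?; apply: nM; left.
  apply: (coord_inj Nh).
  + by move=> ?; apply: nM; right; right.
  + by move=> ?; apply: nM; right; left.
  have H (q : rat) : (h (f x) < ratr q) = (h x < ratr q).
    have nAq : ~ (f @^-1` (A (choice.pickle q)) `+` A (choice.pickle q)) x.
      by move=> ?; apply: nB; exists (choice.pickle q).
    move: nAq; rewrite /A choice.pickleK /preimage /setY /setD /= !in_itv /= => nAq.
    apply/idP/idP => H; apply/negPn/negP => H'; apply: nAq; [left|right];
      by split=> //; apply/negP.
  apply/eqP; case: ltgtP => // hlt.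
    have [q] := rat_in_itvoo hlt; rewrite in_itv /= => /andP[h1 h2].
    by move: (H q); rewrite h1 ltNge (ltW h2).
  have [q] := rat_in_itvoo hlt; rewrite in_itv /= => /andP[h1 h2].
  by move: (H q); rewrite h1 ltNge (ltW h2).
Qed.

(** Ky Fan form of closeness in measure of the coordinates. *)
Let incr (f g : invertible_mpt P) (e : R) : Prop :=
  pr [set x | e < `|h (g x) - h (f x)|] <= e.

Lemma rapid_limit (phi : nat -> invertible_mpt P) :
  (forall k, incr (phi k) (phi k.+1) (2^-1 ^+ k)) ->
  (forall k, incr (mpt_inverse (phi k)) (mpt_inverse (phi k.+1)) (2^-1 ^+ k)) ->
  exists psi : invertible_mpt P, forall A, measurable A ->
    pr (phi k @` A `+` psi @` A) @[k --> \oo] --> (0 : R).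
Proof.
move=> /(limit_map Nh)[theta [mt Pt ct]] /(limit_map Nh)[gamma [mg Pg cg]].
(* $a^{-1}b^{-1}A$ is close to $f_k^{-1}b^{-1}A$, and $b^{-1}A$ is close to $f_k A$, whose preimage
   under $f_k$ is [A]. The two errors tend to 0 and the bounded quantity does not depend on $k$. *)
have inv0 (f : nat -> invertible_mpt P) (a b : X -> X) :
    measurable_fun setT a -> measurable_fun setT b ->
    (forall A, measurable A -> pr (f k @^-1` A `+` a @^-1` A) @[k --> \oo] --> (0 : R)) ->
    (forall A, measurable A ->
      pr (mpt_inverse (f k) @^-1` A `+` b @^-1` A) @[k --> \oo] --> (0 : R)) ->
    forall A, measurable A -> pr ((b \o a) @^-1` A `+` A) = 0.
  move=> ma mb ca cb A mA; have mbA := measurable_preimageT mb mA.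
  apply/eqP; rewrite eq_le pr_ge0 andbT.
  have cab : pr (f k @^-1` (b @^-1` A) `+` a @^-1` (b @^-1` A)) +
      pr (mpt_inverse (f k) @^-1` A `+` b @^-1` A) @[k --> \oo] --> (0 + 0 : R).
    by apply: cvgD; [exact: ca|exact: cb].
  rewrite addr0 in cab.
  rewrite -(cvg_lim _ cab)//; apply: limr_ge.
    by apply/cvg_ex; eexists; exact: cab.
  apply: nearW => k.
  have mfb := measurable_mpt_preimage (f k) mbA.
  have mab := measurable_preimageT ma mbA.
  apply: le_trans (pr_setY_triangle P mab mfb mA) _.
  rewrite [_ `+` f k @^-1` _]setYC lerD2l.
  have mfA := measurable_mpt_preimage (mpt_inverse (f k)) mA.
  rewrite -(pr_preimage (f k) (measurableY mfA mbA)) setYC.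
  rewrite le_eqVlt; apply/orP; left; apply/eqP; congr pr.
  by apply/seteqP; split=> x; rewrite /preimage /setY /setD /= mpt_funK.
have comp0 (a b : X -> X) : measurable_fun setT a -> measurable_fun setT b ->
    (forall A, measurable A -> P (a @^-1` A) = P A) ->
    (forall A, measurable A -> P (b @^-1` A) = P A) ->
    forall A, measurable A -> P ((b \o a) @^-1` A) = P A.
  by move=> ma mb Pa Pb A mA; rewrite comp_preimage Pa ?Pb//; exact: measurable_preimageT.
have invK (f : nat -> invertible_mpt P) : (fun k => mpt_inverse (mpt_inverse (f k))) = f.
  apply/funext => k; case: (f k) => *; rewrite /mpt_inverse /=; congr InvertibleMpt.
  exact: Prop_irrelevance.
have gt0 := inv0 phi _ _ mt mg ct cg.
have tg0 : forall A, measurable A -> pr ((theta \o gamma) @^-1` A `+` A) = 0.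
  apply: (inv0 (fun k => mpt_inverse (phi k))) => //.
have [Z1 [mZ1 Z11 Z1K]] :=
  measure_class_ae_id (measurableT_comp mg mt) (comp0 _ _ mt mg Pt Pg) gt0.
have [Z2 [mZ2 Z21 Z2K]] :=
  measure_class_ae_id (measurableT_comp mt mg) (comp0 _ _ mg mt Pg Pt) tg0.
have mZ : measurable (Z1 `&` Z2) by exact: measurableI.
have Z1' : pr (Z1 `&` Z2) = 1 by rewrite pr_setI1.
have [|psi hpsi] := ae_inverse_mpt mt mg Pt Pg mZ Z1' (fun x Zx => Z1K x Zx.1).
  by move=> x [_ /Z2K].
exists psi => A mA; apply: (squeeze_cvgr _ (cvg_cst 0) (cg A mA)).
apply: nearW => k; rewrite pr_ge0 /=.
have mk := measurable_mpt_image (phi k) mA.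
have mpsi := measurable_mpt_image psi mA.
have mgA := measurable_preimageT mg mA.
apply: le_trans (pr_setY_triangle P mk mgA mpsi) _.
by rewrite [gamma @^-1` A `+` _]setYC hpsi// addr0 mpt_imageE.
Qed.

(** Two points with the same label have coordinates within [e], so it suffices that labels agree
    outside measure [e]. [L1] compares the inverse maps on the cells; [L2], whose members [phi]
    sends onto cells, compares the maps themselves. Dividing [e] by the number of cells pays for the
    sum. *)
Lemma incr_nbhs (phi : Phi P) (e : R) : 0 < e ->
  nbhs phi [set psi : Phi P | incr phi psi e /\
    incr (mpt_inverse phi) (mpt_inverse psi) e].
Proof.
move=> e0; pose n := Num.truncn e^-1.
have ne : n.+1%:R^-1 <= e.
  rewrite -[leRHS]invrK lef_pV2 ?posrE ?invr_gt0 ?ltr0n//.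
  have e0' : 0 <= e^-1 by rewrite invr_ge0 ltW.
  by have /andP[_ /ltW] := truncn_itv e0'.
have [p [mp _ hp]] := coordinate_label Nh n.
pose L1 := [seq [set x | p x = j] | j <- enum 'I_n.+1].
pose L2 := [seq phi @^-1` [set x | p x = j] | j <- enum 'I_n.+1].
pose e' := e / n.+1%:R.
have e'0 : 0 < e' by rewrite divr_gt0.
have mL A : A \in L1 ++ L2 -> measurable A.
  rewrite mem_cat => /orP[] /mapP[j _ ->//]; exact: measurable_mpt_preimage.
apply: filterS (weak_nbhs phi mL e'0) => psi hpsi.
have key (f g : X -> X) : measurable_fun setT f -> measurable_fun setT g ->
    (forall j, pr (g @^-1` [set x | p x = j] `+` f @^-1` [set x | p x = j]) <= e') ->
    pr [set x | e < `|h (g x) - h (f x)|] <= e.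
  move=> mf mg hj.
  have mfj j := measurable_preimageT mf (mp j); have mgj j := measurable_preimageT mg (mp j).
  pose S := [set x | e < `|h (g x) - h (f x)|].
  have mS : measurable S.
    rewrite -[X in measurable X]setTI; apply: measurable_fun_ltr => //.
    apply: measurableT_comp => //; apply: measurable_funB;
      by apply: measurableT_comp => //; exact: (coord_meas Nh).
  have := pr_label P mfj xpredT mS.
  rewrite (_ : S `&` _ = S); last by apply/seteqP; split=> x // [].
  move=> ->; have -> : e = \sum_(j : 'I_n.+1) e'.
    by rewrite sumr_const card_ord -mulr_natr /e' divfK// gt_eqF.
  apply: ler_sum => j _; apply: le_trans _ (hj j).
  apply: pr_le; [exact: measurableI mS (mfj j)|exact: measurableY|].
  move=> x [Sx fx]; right; split=> //= gx.
  have : `|h (g x) - h (f x)| <= n.+1%:R^-1 by apply: hp; rewrite gx fx.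
  by move/le_trans => /(_ _ ne); rewrite leNgt Sx.
split; apply: key; try exact: measurable_mpt_fun.
  move=> j; have mj := mp j.
  have jL : phi @^-1` [set x | p x = j] \in L1 ++ L2.
    by rewrite mem_cat; apply/orP; right; apply/mapP; exists j; rewrite ?mem_enum.
  apply: le_trans _ (ltW (hpsi _ jL)).
  have mpj := measurable_mpt_preimage phi mj.
  have mY : measurable (psi @` (phi @^-1` [set x | p x = j]) `+`
      phi @` (phi @^-1` [set x | p x = j])).
    by apply: measurableY; exact: measurable_mpt_image.
  rewrite -(pr_preimage psi mY) le_eqVlt; apply/orP; left; apply/eqP.
  rewrite setYC; congr pr; rewrite !mpt_imageE.
  by apply/funext => x; rewrite /preimage /setY /setD /setU /mkset /= mpt_funK mpt_invK.
move=> j; have jL : [set x | p x = j] \in L1 ++ L2.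
  by rewrite mem_cat; apply/orP; left; apply/mapP; exists j; rewrite ?mem_enum.
by apply: le_trans _ (ltW (hpsi _ jL)); rewrite !mpt_imageE.
Qed.

Lemma Phi_baire (O : nat -> set (Phi P)) :
  (forall k, open (O k)) -> (forall k, dense (O k)) -> dense (\bigcap_k O k).
Proof.
move=> oO dO U [phi0 U0] oU.
(* A state is a centre, a finite list of sets to be tested and a radius. Lists grow so that earlier
   constraints persist, and closed balls of twice the radius are what the limit will belong to. *)
pose state : Type := Phi P * seq (set X) * R.
pose valid (s : state) := (forall A, A \in s.1.2 -> measurable A) /\ 0 < s.2.
pose step k (s s' : state) :=
  [/\ valid s',
      incr s.1.1 s'.1.1 (2^-1 ^+ k) /\
      incr (mpt_inverse s.1.1) (mpt_inverse s'.1.1) (2^-1 ^+ k),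
      forall A, A \in s.1.2 ->
        A \in s'.1.2 /\ pr (s'.1.1 @` A `+` s.1.1 @` A) < s.2,
      s'.2 <= s.2 / 2 &
      forall psi : Phi P,
        (forall A, A \in s'.1.2 -> pr (psi @` A `+` s'.1.1 @` A) <= 2 * s'.2) ->
        O k psi].
have stepP (ks : nat * state) : exists s', valid ks.2 -> step ks.1 ks.2 s'.
  case: ks => k [[phi L] e] /=; have [[mL e0]|nv] := pselect (valid (phi, L, e)); last first.
    by exists (phi, L, e) => v; case: nv.
  have k0 : 0 < 2^-1 ^+ k :> R by rewrite exprn_gt0.
  have := filterI (weak_nbhs phi mL e0) (incr_nbhs phi k0).
  set V := _ `&` _ => nV.
  have V0 : V° !=set0 by exists phi; exact: nV.
  have [phi' [/interior_subset [V1 V2] Ophi']] := dO k _ V0 (open_interior V).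
  have [L' [e' [mL' e'0 hL']]] := weak_basis (oO k) Ophi'.
  (* With radius at most $e'/4$ the doubled closed ball still lies strictly inside the open ball of
     radius $e'$ contained in [O k]. *)
  have ee0 : 0 < Num.min (e / 2) (e' / 4) by rewrite lt_min !divr_gt0.
  exists (phi', L ++ L', Num.min (e / 2) (e' / 4)) => _; split=> //=.
  - by split=> // A; rewrite mem_cat => /orP[/mL|/mL'].
  - by move=> A AL; split; [rewrite mem_cat AL|exact: V1].
  - by rewrite ge_min lexx.
  - move=> psi hpsi; apply: hL' => A AL'.
    apply: (@le_lt_trans _ _ (2 * Num.min (e / 2) (e' / 4))).
      by apply: hpsi; rewrite mem_cat AL' orbT.
    have : Num.min (e / 2) (e' / 4) <= e' / 4 by rewrite ge_min lexx orbT.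
    lra.
have [next nextP] := choice stepP.
have [L0 [e0 [mL0 e00 hU]]] := weak_basis oU U0.
pose s := fix s k : state := if k is j.+1 then next (j, s j) else (phi0, L0, e0 / 4).
have vs k : valid (s k).
  elim: k => [|k IH]; first by split=> //=; rewrite divr_gt0.
  by have [] := nextP (k, s k) IH.
have hs k : step k (s k) (s k.+1) := nextP (k, s k) (vs k).
have [||psi hpsi] := @rapid_limit (fun k => (s k).1.1).
- by move=> k; have [_ []] := hs k.
- by move=> k; have [_ []] := hs k.
(* A step moves less than the current radius $e_k$, and $e_k \le 2e_k - 2e_{k+1}$ because radii at
   least halve: the displacements telescope. *)
have close k m A : A \in (s k).1.2 -> A \in (s (k + m)%N).1.2 /\
    pr ((s (k + m)%N).1.1 @` A `+` (s k).1.1 @` A) <= 2 * (s k).2 - 2 * (s (k + m)%N).2.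
  move=> Ak; have mA : measurable A by have [h1 _] := vs k; exact: h1.
  elim: m => [|m [IHA IH]]; first by rewrite addn0 setYK pr0 subrr.
  rewrite addnS; have [_ _ /(_ A IHA)[AS lt1] le2 _] := hs (k + m)%N.
  split=> //.
  have mI (f : Phi P) := measurable_mpt_image f mA.
  apply: le_trans (pr_setY_triangle P (mI _) (mI (s (k + m)%N).1.1) (mI _)) _.
  lra.
pose Psi : Phi P := (\pi_(Phi P) psi)%qT.
have lim_close k A : A \in (s k).1.2 -> pr (Psi @` A `+` (s k).1.1 @` A) <= 2 * (s k).2.
  move=> Ak; have mA : measurable A by have [h1 _] := vs k; exact: h1.
  have mk := measurable_mpt_image (s k).1.1 mA.
  have mpsi := measurable_mpt_image psi mA.
  rewrite (ae_eq_image (Phi_repr_pi psi) mA mk).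
  have : pr (psi @` A `+` (s k).1.1 @` A) - 2 * (s k).2 <= 0.
    rewrite -(cvg_lim _ (hpsi A mA))//; apply: limr_ge.
      by apply/cvg_ex; eexists; exact: hpsi.
    exists k => // m /= km; rewrite -(subnKC km).
    have mm := measurable_mpt_image (s (k + (m - k))%N).1.1 mA.
    have := pr_setY_triangle P mpsi mm mk.
    have [_] := close k (m - k)%N A Ak.
    have [_ e1] := vs (k + (m - k))%N.
    rewrite [_ `+` psi @` A]setYC; lra.
  by rewrite subr_le0.
exists Psi; split.
  apply: hU => A AL; have := lim_close 0%N A AL => /=.
  by move/le_lt_trans; apply; lra.
by move=> k _; have [_ _ _ _] := hs k; apply; move=> A; exact: lim_close.
Qed.

End baire.

(** * Non-uniformity of ergodic averages *)

Section nonuniform.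
Context (R : realType) (d : measure_display) (X : measurableType d).
Variable P : probability X R.
Variable T : invertible_mpt P.
Local Notation pr := (pr P).

Definition correlation n (D W : set X) : R :=
  n.+1%:R^-1 * (\sum_(i < n.+1) pr ([set x | D (iter i T x)] `&` W)).

Lemma correlation_dist n D D' W :
  measurable D -> measurable D' -> measurable W ->
  `|correlation n D W - correlation n D' W| <= pr (D `+` D').
Proof.
move=> mD mD' mW; rewrite /correlation -mulrBr -sumrB normrM ger0_norm ?invr_ge0//.
rewrite ler_pdivrMl ?ltr0n//.
apply: le_trans (ler_norm_sum _ _ _) _.
have -> : n.+1%:R * pr (D `+` D') = \sum_(i < n.+1) pr (D `+` D').
  by rewrite sumr_const card_ord mulr_natl.
apply: ler_sum => i _.
rewrite -(pr_iter T i (measurableY mD mD')).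
by apply: pr_distI => //; exact: measurable_iter.
Qed.

Lemma conjugate_iter (phi : invertible_mpt P) i x :
  iter i (conjugate T phi) x = mpt_inv phi (iter i T (phi x)).
Proof.
elim: i => [|i IH]; first by rewrite /= mpt_funK.
by rewrite iterS IH /conjugate /= mpt_invK.
Qed.

(** Pair the centred average [F] with the indicator of $V = \phi^{-1}W$. The inequality $\int F 1_V
    \le \int |F|$ is rearranged into $\int G \le \int |F| + \int \mu(A) 1_V$, where all integrands
    are nonnegative. *)
Lemma integral_average_ge (phi : invertible_mpt P) (A W : set X) n :
  measurable A -> measurable W ->
  ((correlation n (phi @` A) W - pr A * pr W)%:E <=
   \int[P]_x (`|n.+1%:R^-1 *
       (\sum_(0 <= i < n.+1) \1_A (iter i (conjugate T phi) x)) - pr A|)%:E)%E.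
Proof.
move=> mA mW; have mD := measurable_mpt_image phi mA.
pose D i := [set y | (phi @` A) (iter i T y)].
have mDi i : measurable (D i) by exact: measurable_iter.
pose S i := phi @^-1` D i.
have mS i : measurable (S i) by exact: measurable_mpt_preimage.
pose V := phi @^-1` W.
have mV : measurable V by exact: measurable_mpt_preimage.
have mSV i : measurable (S i `&` V) by exact: measurableI.
have AS i x : \1_A (iter i (conjugate T phi) x) = \1_(S i) x :> R.
  rewrite !indicE (_ : (_ \in A) = (x \in S i))//.
  apply/idP/idP; rewrite !inE conjugate_iter.
    by move=> Ax; exists (mpt_inv phi (iter i T (phi x))) => //; rewrite mpt_invK.
  by case=> a Aa <-; rewrite mpt_funK.
pose F x := n.+1%:R^-1 * (\sum_(i < n.+1) \1_(S i) x) - pr A.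
have FE x : n.+1%:R^-1 *
    (\sum_(0 <= i < n.+1) \1_A (iter i (conjugate T phi) x)) - pr A = F x.
  rewrite /F big_mkord; congr (_ * _ - _).
  by apply: eq_bigr => i _; exact: AS.
under eq_integral do rewrite FE.
have mF : measurable_fun setT F.
  apply: measurable_funB => //; apply: measurable_funM => //.
  by apply: measurable_sum => i; exact: measurable_indic.
have i0 : 0 <= n.+1%:R^-1 :> R by rewrite invr_ge0.
pose G x : R := n.+1%:R^-1 * (\sum_(i < n.+1) \1_(S i `&` V) x).
have intG : (\int[P]_x (G x)%:E = (correlation n (phi @` A) W)%:E)%E.
  under eq_integral do rewrite EFinM -sumEFin.
  rewrite ge0_integralZl//; last 2 first.
  - apply: emeasurable_sum => i; apply/measurable_EFinP; exact: measurable_indic.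
  - by move=> x _; apply: sume_ge0 => i _; rewrite lee_fin.
  rewrite ge0_integral_sum//; last first.
    by move=> i; apply/measurable_EFinP; exact: measurable_indic.
  rewrite /correlation EFinM -sumEFin; congr (_ * _)%E.
  apply: eq_bigr => i _; rewrite integral_indic// setIT.
  have mDW := measurableI _ _ (mDi i) mW.
  by rewrite -(pr_preimage phi mDW); exact: (prE P (mSV i)).
have intV : (\int[P]_x (pr A * \1_V x)%:E = (pr A * pr W)%:E)%E.
  under eq_integral do rewrite EFinM.
  rewrite ge0_integralZl//; last 2 first.
  - by apply/measurable_EFinP; exact: measurable_indic.
  - exact: pr_ge0.
  rewrite integral_indic// setIT -(pr_preimage phi mW) EFinM; congr (_ * _)%E.
  exact: (prE P mV).
have mnF : measurable_fun setT (fun x => (`|F x|)%:E).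
  by apply/measurable_EFinP; exact: measurableT_comp.
have mPV : measurable_fun setT (fun x => (pr A * \1_V x)%:E).
  by apply/measurable_EFinP; apply: measurable_funM => //; exact: measurable_indic.
have mG : measurable_fun setT (fun x => (G x)%:E).
  apply/measurable_EFinP; apply: measurable_funM => //.
  by apply: measurable_sum => i; exact: measurable_indic.
have PV0 x : [set: X] x -> (0 <= (pr A * \1_V x)%:E)%E.
  by move=> _; rewrite lee_fin mulr_ge0// pr_ge0.
rewrite EFinB leeBlDr// -intV -ge0_integralD// -intG.
apply: ge0_le_integral => //.
- by move=> x Dx; rewrite lee_fin /G mulr_ge0// sumr_ge0.
- exact: emeasurable_funD.
move=> x _; rewrite -EFinD lee_fin /G.
under eq_bigr do rewrite indicI /=.
rewrite -mulr_suml mulrA.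
have -> : n.+1%:R^-1 * \sum_(i < n.+1) \1_(S i) x = F x + pr A by rewrite /F subrK.
rewrite indicE; case: (_ \in _); last by rewrite !mulr0 addr0.
by rewrite !mulr1 lerD2r ler_norm.
Qed.

End nonuniform.

Theorem theorem2 (R : realType) (d : measure_display) (X : measurableType d)
    (P : probability X R) (hP : lebesgue_space P)
    (T : invertible_mpt P) (hT : ergodic T)
    (C : set (set X)) (hC : C `<=` measurable)
    (hH : (0 < family_entropy P C)%E) :
  exists G : set (Phi P),
    [/\ dense G, Gdelta G &
      forall phi : Phi P, G phi ->
        (0 < limn_esup (fun n : nat =>
           ereal_sup
             [set \int[P]_x
                    (`|n%:R^-1 * (\sum_(0 <= i < n) \1_A (iter i (conjugate T phi) x))
                       - fine (P A)|)%:E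
             | A in C]))%E].
Proof.
have [N [h Nh]] := lebesgue_space_coordinate hP.
have fineP := coordinate_finely_divisible Nh.
have [c c0 hc] := family_entropy_separation hC hH.
(* [W] may depend on [phi] and on [n]; keeping it fixed while [phi] varies a little is what makes
   the condition open. *)
pose O n := [set phi : Phi P | exists A W, [/\ C A, measurable W &
  c / 4 < correlation T n (phi @` A) W - pr P A * pr P W]].
have oO n : open (O n).
  apply: weak_openP => phi [A [W [CA mW hAW]]]; have mA := hC _ CA.
  exists [:: A], (correlation T n (phi @` A) W - pr P A * pr P W - c / 4).
  split; [by move=> B; rewrite inE => /eqP ->|by rewrite subr_gt0|].
  move=> psi /(_ A (mem_head _ _)) hpsi; exists A, W; split=> //.
  have := correlation_dist T n (measurable_mpt_image psi mA)
    (measurable_mpt_image phi mA) mW.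
  rewrite ler_norml; lra.
have dO n : dense (O n).
  move=> U U0 oU; have [phi0 {}U0] : exists phi0 : Phi P, U phi0 by [].
  have [L [e [mL e0 hL]]] := weak_basis oU U0.
  (* [Q] is generated by the images under [phi0] of the sets defining the neighbourhood, so a
     [sigma] preserving [Q] fixes these images and [sigma] after [phi0] stays in [U]. *)
  pose S i := phi0 @` nth set0 L i.
  have mS i : measurable (S i).
    apply: measurable_mpt_image; have [iL|iL] := ltnP i (size L).
      by apply: mL; exact: mem_nth.
    by rewrite nth_default.
  pose Q := pattern S (size L).
  have mQ b : measurable [set x | Q x = b] by exact: measurable_pattern.
  (* Separation is applied to the pulled-back partition [Q \o phi0]; transported by [phi0], it says
     that $\phi_0 A$ is far from all unions of cells of [Q]. *)
  have [A CA hA] := hc _ (Q \o phi0) (fun b => measurable_mpt_preimage phi0 (mQ b)).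
  have mA := hC _ CA; have mD := measurable_mpt_image phi0 mA.
  have hD (s : {ffun 'I_(size L) -> bool} -> bool) :
      c < pr P [set x | `[< (phi0 @` A) x >] != s (Q x)].
    apply: lt_le_trans (hA s) _.
    have mY := measurable_label_neq mQ s mD.
    rewrite -(pr_preimage phi0 mY) le_eqVlt; apply/orP; left; apply/eqP; congr pr.
    apply/funext => x; rewrite /preimage /= (_ : `[< (phi0 @` A) (phi0 x) >] = `[< A x >])//.
    apply: asbool_equiv_eq; split=> [[y Ay]|Ax]; last by exists x.
    by move/(can_inj (@mpt_funK _ _ _ _ phi0)) => <-.
  have [sigma [W [sQ mW hW]]] := bad_average n hT fineP mQ mD c0 hD.
  pose psi : Phi P := (\pi_(Phi P) (mpt_comp sigma phi0))%qT.
  have psiE := Phi_repr_pi (mpt_comp sigma phi0).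
  have imE (B : set X) : mpt_comp sigma phi0 @` B = sigma @` (phi0 @` B).
    by rewrite /= image_comp.
  exists psi; split.
    apply: hL => B BL; have mB := mL _ BL.
    rewrite (ae_eq_image psiE mB (measurable_mpt_image phi0 mB)) imE.
    suff -> : sigma @` (phi0 @` B) = phi0 @` B by rewrite setYK pr0.
    have SB : phi0 @` B = S (index B L) by rewrite /S nth_index.
    have iL : (index B L < size L)%N by rewrite index_mem.
    have QB x y : Q x = Q y -> (phi0 @` B) x -> (phi0 @` B) y.
      move=> Qxy; rewrite SB => Sx.
      have := congr1 (fun f : {ffun _ -> bool} => f (Ordinal iL)) Qxy.
      by rewrite !ffunE /= (asboolT Sx) => /esym/asboolP.
    apply/seteqP; split=> y.
      by case=> z Bz <-; apply: QB Bz; rewrite sQ.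
    move=> By; exists (mpt_inv sigma y); last by rewrite mpt_invK.
    by apply: QB By; rewrite -[in LHS](mpt_invK sigma y) sQ.
  exists A, W; split=> //.
  (* The representative of [psi] may differ from [mpt_comp sigma phi0]; the two images of [A] are at
     distance 0, so their correlations agree. *)
  have mcomp := measurable_mpt_image (mpt_comp sigma phi0) mA.
  have := correlation_dist T n (measurable_mpt_image psi mA) mcomp mW.
  rewrite (ae_eq_image psiE mA mcomp) setYK pr0 normr_le0 subr_eq0 => /eqP ->.
  by rewrite imE -(pr_image phi0 mA).
exists (\bigcap_n O n); split.
- exact: (Phi_baire Nh).
- by exists O.
move=> phi Gphi; apply: (@lt_le_trans _ _ (c / 4)%:E).
  by rewrite lte_fin divr_gt0.
(* The bound holds for every average with at least one term; [O n] concerns $n+1$ terms, so only the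
   empty average is discarded. *)
apply: limn_esup_ge; exists 1%N => // -[//|n] _ /=.
have [A [W [CA mW hAW]]] := Gphi n I.
apply: le_trans (ereal_sup_ubound _); last by exists A.
apply: le_trans _ (integral_average_ge T phi n (hC _ CA) mW).
by rewrite lee_fin ltW.
Qed.
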